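(* (Exponential decay of correlations.) Let $(X,T,\Omega,P,\theta)$ be a random countable topological Markov chain with the b.i.p.-property and let $\varphi$ be a potential such that $(\hat{\mathrm{H}})$ holds and $\mathcal{L}_\omega(1)=1$ a.s. Let $\{\mu_\omega\}$ be the unique random probability measure with $\mathcal{L}_\omega^\ast(\mu_{\theta\omega})=\mu_\omega$ a.s. Then there exist constants $t\in(0,1)$, $c\in(0,\infty)$ and random sequences $(k_n(\omega):n\in\mathbb{N})$, $(l_n(\omega):n\in\mathbb{N})$ in $\mathbb{N}$ such that for every fibrewise Lipschitz continuous $f=\{f_\omega\}$ with $\int f_\omega\,d\mu_\omega=0$ a.s., every measurable $g=\{g_\omega\}$ with $\int|g_\omega|\,d\mu_\omega<\infty$ a.s., every $n\in\mathbb{N}$ and a.e. $\omega\in\Omega$, writing $l=l_n(\omega)$ and $k=k_n(\omega)$, $$\left|\int f_\omega\cdot g_{\theta^{l}\omega}\circ T^{l}_\omega\,d\mu_\omega\right|\le2c\,t^n\,D_\omega(f)\int|g_{\theta^l\omega}|\,d\mu_{\theta^{l}\omega},$$ $$\left|\int f_{\theta^{-k}\omega}\cdot g_\omega\circ T^{k}_{\theta^{-k}\omega}\,d\mu_{\theta^{-k}\omega}\right|\le4B_\omega\,t^n\,D_{\theta^{-k}\omega}(f)\int|g_\omega|\,d\mu_\omega.$$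
   Context: **Random countable topological Markov chain.** $\theta$ is an ergodic automorphism (invertible, bimeasurable, probability preserving, ergodic) of a probability space $(\Omega,\mathcal{F},P)$; $\{\mathcal{W}^1_\omega\}$ is a measurable family of subsets of $\mathbb{N}$; for a.e. $\omega$, $A_\omega=(\alpha^\omega_{ij}:i\in\mathcal{W}^1_\omega,j\in\mathcal{W}^1_{\theta\omega})$ is a matrix with entries in $\{0,1\}$, measurable in $\omega$, with $\sum_{j\in\mathcal{W}^1_{\theta\omega}}\alpha^\omega_{ij}>0$ and $\sum_{j\in\mathcal{W}^1_{\theta^{-1}\omega}}\alpha^{\theta^{-1}\omega}_{ji}>0$ for all $i\in\mathcal{W}^1_\omega$. Put $X_\omega=\{(x_0,x_1,\dots):\alpha^{\theta^i\omega}_{x_ix_{i+1}}=1\ \forall i\ge0\}$, $T_\omega:X_\omega\to X_{\theta\omega}$ the shift, $X=\{(\omega,x):x\in X_\omega\}$ (measurable structure induced from $\mathbb{N}^{\mathbb{N}}\times\Omega$), $T(\omega,x)=(\theta\omega,T_\omega x)$, $T^n_\omega=T_{\theta^{n-1}\omega}\circ\cdots\circ T_\omega$. $\mathcal{W}^n_\omega$ is the set of $\omega$-admissible words $(x_0,\dots,x_{n-1})$, i.e. $x_i\in\mathcal{W}^1_{\theta^i\omega}$ and $\alpha^{\theta^i\omega}_{x_ix_{i+1}}=1$ for consecutive letters; $[a]_\omega=\{x\in X_\omega:x_i=a_i,\ 0\le i<n\}$; $\Omega_a=\{\omega:[a]_\omega\neq\emptyset\}$; $\mathcal{W}^n$ is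 the set of words $a$ of length $n$ with $P(\Omega_a)>0$. For $r\in(0,1)$, $d_r(x,y)=r^{\min\{i:x_i\ne y_i\}}$. **Random probability measure** $\mu=\{\mu_\omega\}$: a map $(B,\omega)\mapsto\mu_\omega(B)\in[0,1]$ on (Borel sets of $\mathbb{N}^{\mathbb{N}}$)$\times\Omega$ which is measurable in $\omega$ for each $B$ and such that, for a.e. $\omega$, $\mu_\omega$ is a probability measure with support $X_\omega$. **b.i.p.-property.** $(X,T)$ is topologically mixing if for all $a,b\in\mathcal{W}^1$ there is an $\mathbb{N}$-valued random variable $N_{ab}$ such that $[a]_\omega\cap(T^n_\omega)^{-1}[b]_{\theta^n\omega}\neq\emptyset$ whenever $n\ge N_{ab}(\omega)$, $a\in\mathcal{W}^1_\omega$ and $\theta^n\omega\in\Omega_b$. $(X,T)$ has the b.i.p.-property if it is topologically mixing and there are $\Omega_{\rm bi},\Omega_{\rm bp}\subset\Omega$ of positive measure and a finite $\mathcal{I}\subset\mathbb{N}$ such that (1) for $\omega\in\Omega_{\rm bi}$, $a\in\mathcal{W}^1_{\theta^{-1}\omega}$ there is $b\in\mathcal{I}$ with $ab\in\mathcal{W}^2_{\theta^{-1}\omega}$; (2) for $\omega\in\Omega_{\rm bp}$, $a\in\mathcal{W}^1_\omega$ there is $b\in\mathcal{I}$ with $ba\in\mathcal{W}^2_{\theta^{-1}\omega}$. **Hölder continuity.** For $f:X\to\mathbb{R}$, $f_\omega=f|_{X_\omega}$, $V^\omega_n(f)=\sup\{|f_\omega(x)-f_\omega(y)|:x_i=y_i,\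 0\le i<n\}$. $f$ is locally Hölder continuous with parameter $r$ and index $k$ if there is a random variable $\kappa\ge0$ with $\int\log\kappa\,dP<\infty$ and $V^\omega_n(f)\le\kappa(\omega)r^n$ for all $n\ge k$. $D_\omega(f)=\sup\{|f_\omega(x)-f_\omega(y)|/d_r(x,y):x\neq y\in X_\omega\}$; $f$ is fibrewise Lipschitz continuous if $D_\omega(f)<\infty$ a.s. ($r$ being the Hölder parameter of $\varphi$). **Ruelle operator.** For measurable $\varphi:X\to\mathbb{R}$, $\mathcal{L}_\omega(f)(x)=\sum_{y\in X_\omega:T_\omega y=x}e^{\varphi_\omega(y)}f(y)$ ($x\in X_{\theta\omega}$), $\int f\,d\mathcal{L}_\omega^\ast(\mu)=\int\mathcal{L}_\omega(f)\,d\mu$. $(\hat{\mathrm{H}})$: $\varphi$ is locally Hölder continuous with index $2$ (with parameter $r$ and random variable $\kappa$) and $V^\omega_1(\varphi)<\infty$ for a.e. $\omega\in\theta^{-1}(\Omega_{\rm bi}\cup\Omega_{\rm bp})$. $B_\omega:=\exp\sum_{k=1}^\infty\kappa(\theta^{-k}\omega)r^k$ (a.s. finite). A random sequence is a sequence of measurable $\mathbb{N}$-valued functions of $\omega$. *)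

(* Defs.v *)
From mathcomp Require Import all_boot all_order all_algebra.
From mathcomp Require Import all_classical all_reals all_analysis.
From mathcomp Require Import measurable_realfun.
Import Order.TTheory GRing.Theory Num.Theory.
Import numFieldNormedType.Exports.

Set Implicit Arguments.
Unset Strict Implicit.
Unset Printing Implicit Defensive.

Local Open Scope classical_set_scope.
Local Open Scope ring_scope.

(* Sequences of naturals with the Borel sigma-algebra of the product of the
   discrete topologies. *)
Notation natseq := (g_sigma_algebraType (@open {ptws nat -> nat})).

(* Every T_omega is a restriction of [shift_seq], so T_omega^n is one
   of [iter n shift_seq], whatever omega. *)
Definition shift_seq (x : natseq) : natseq := fun i => x i.+1.

(* r to the power min {i | x_i <> y_i}, and 0 when x = y *)
Definition dist_r (R : realType) (r : R) (x y : natseq) : R :=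
  if pselect (exists i, x i != y i) is left e then r ^+ (ex_minn e) else 0.

(* The inverse of an automorphism [theta] is carried along as [thetaV]. *)
Record ergodic_automorphism d (Omega : measurableType d) (R : realType)
    (P : probability Omega R) (theta thetaV : Omega -> Omega) : Prop := {
  automorphism_cancel : cancel theta thetaV ;
  automorphism_cancelV : cancel thetaV theta ;
  automorphism_measurable : measurable_fun setT theta ;
  automorphism_measurableV : measurable_fun setT thetaV ;
  automorphism_preserving :
    forall A, measurable A -> P (theta @^-1` A) = P A ;
  automorphism_ergodic : forall A, measurable A ->
    theta @^-1` A = A -> P A = 0%E \/ P A = 1%E }.

(* [W1 w] is the alphabet at w. The matrix at w is indexed by
   W1 w x W1 (theta w): the other values of [alpha w] are irrelevant. *)
Record random_tmc d (Omega : measurableType d) (R : realType)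
    (P : probability Omega R) (theta thetaV : Omega -> Omega)
    (W1 : Omega -> set nat) (alpha : Omega -> nat -> nat -> bool) : Prop := {
  tmc_alphabet : forall i, measurable [set w | W1 w i] ;
  tmc_matrix : forall i j,
    measurable_fun [set w | W1 w i /\ W1 (theta w) j]
                   (fun w => alpha w i j) ;
  tmc_row : {ae P, forall w, forall i, W1 w i ->
    (0 < \esum_(j in W1 (theta w)) (alpha w i j)%:R%:E :> \bar R)%E} ;
  tmc_col : {ae P, forall w, forall i, W1 w i ->
    (0 < \esum_(j in W1 (thetaV w)) (alpha (thetaV w) j i)%:R%:E
       :> \bar R)%E} }.

Section chain.
Context d (Omega : measurableType d) (R : realType).
Variables (P : probability Omega R) (theta thetaV : Omega -> Omega).
Variables (W1 : Omega -> set nat) (alpha : Omega -> nat -> nat -> bool).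

(* X_omega *)
Definition fibre (w : Omega) : set natseq :=
  [set x | forall i, W1 (iter i theta w) (x i) /\
                     alpha (iter i theta w) (x i) (x i.+1)].

Definition total_space : set (Omega * natseq) :=
  [set wx | fibre wx.1 wx.2].

(* W^n_omega *)
Definition words (n : nat) (w : Omega) : set (seq nat) :=
  [set a | [/\ size a = n,
    forall i, (i < n)%N -> W1 (iter i theta w) (nth 0%N a i) &
    forall i, (i.+1 < n)%N ->
      alpha (iter i theta w) (nth 0%N a i) (nth 0%N a i.+1)]].

Definition cylinder (a : seq nat) (w : Omega) : set natseq :=
  [set x | fibre w x /\ forall i, (i < size a)%N -> x i = nth 0%N a i].

Definition Omega_word (a : seq nat) : set Omega :=
  [set w | cylinder a w !=set0].

(* W^n. [Omega_word a] is measurable only up to a null set, whence the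
   negligibility for the completion of P. *)
Definition global_words (n : nat) : set (seq nat) :=
  [set a | size a = n /\ ~ P.-negligible (Omega_word a)].

Definition top_mixing : Prop :=
  forall a b : nat, global_words 1 [:: a] -> global_words 1 [:: b] ->
  exists N : Omega -> nat, measurable_fun setT N /\
    {ae P, forall w, forall n, (N w <= n)%N -> W1 w a ->
       Omega_word [:: b] (iter n theta w) ->
       cylinder [:: a] w `&`
       (iter n shift_seq @^-1` cylinder [:: b] (iter n theta w)) !=set0}.

(* The witnesses of the big images and preimages are arguments, because the
   condition on the potential below refers to them. *)
Record bip (Omega_bi Omega_bp : set Omega) (I : set nat) : Prop := {
  bip_mixing : top_mixing ;
  bip_bi_measurable : measurable Omega_bi ;
  bip_bp_measurable : measurable Omega_bp ;
  bip_bi_gt0 : (0 < P Omega_bi)%E ;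
  bip_bp_gt0 : (0 < P Omega_bp)%E ;
  bip_finite : finite_set I ;
  bip_images : forall w, Omega_bi w -> forall a, W1 (thetaV w) a ->
    exists2 b, I b & words 2 (thetaV w) [:: a; b] ;
  bip_preimages : forall w, Omega_bp w -> forall a, W1 w a ->
    exists2 b, I b & words 2 (thetaV w) [:: b; a] }.

(* Functions on X are total functions of (w, x), of which only the values for
   x in [fibre w] are ever used. [total_space] is measurable, so that this is
   measurability for the trace sigma-algebra. *)
Definition measurable_on_X (f : Omega -> natseq -> R) : Prop :=
  measurable_fun total_space (fun wx => f wx.1 wx.2).

Definition variation (n : nat) (w : Omega) (f : Omega -> natseq -> R) : \bar R :=
  ereal_sup [set z | exists x y, [/\ fibre w x, fibre w y,
    forall i, (i < n)%N -> x i = y i & z = `|f w x - f w y|%:E]].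

(* The integral of log kappa exists in [-oo, +oo[ iff that of its positive part
   is finite; the library's integral of a function whose positive and negative
   parts both have integral +oo is -oo. *)
Definition locally_holder (r : R) (kappa : Omega -> R) (k : nat)
    (f : Omega -> natseq -> R) : Prop :=
  [/\ measurable_fun setT kappa,
      forall w, 0 <= kappa w,
      (\int[P]_w maxe (lne (kappa w)%:E) 0 < +oo)%E &
      {ae P, forall w, forall n, (k <= n)%N ->
        (variation n w f <= (kappa w * r ^+ n)%:E)%E}].

(* D_omega(f); 0 is added so that the supremum over an empty set of pairs
   is 0. *)
Definition lipschitz_const (r : R) (w : Omega) (f : Omega -> natseq -> R) :
    \bar R :=
  ereal_sup [set z | z = 0%E \/ exists x y, [/\ fibre w x, fibre w y,
    x <> y & z = (`|f w x - f w y| / dist_r r x y)%:E]].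

Definition fibrewise_lipschitz (r : R) (f : Omega -> natseq -> R) : Prop :=
  {ae P, forall w, (lipschitz_const r w f < +oo)%E}.

(* The sum over preimages, for its absolutely convergent or nonnegative
   instances: the sum of the positive parts minus that of the negative parts. *)
Definition ruelle (phi : Omega -> natseq -> R) (w : Omega) (f : natseq -> R)
    (x : natseq) : \bar R :=
  let D := [set y | fibre w y /\ shift_seq y = x] in
  let F y := (expR (phi w y) * f y)%:E in
  (\esum_(y in D) maxe (F y) 0 - \esum_(y in D) maxe (- F y) 0)%E.

Definition H_hat (Omega_bi Omega_bp : set Omega) (r : R) (kappa : Omega -> R)
    (phi : Omega -> natseq -> R) : Prop :=
  locally_holder r kappa 2 phi /\
  {ae P, forall w, (Omega_bi `|` Omega_bp) (theta w) ->
    (variation 1 w phi < +oo)%E}.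

(* B_omega *)
Definition holder_bound (r : R) (kappa : Omega -> R) (w : Omega) : \bar R :=
  expeR (\sum_(1 <= k <oo) (kappa (iter k thetaV w) * r ^+ k)%:E)%E.

Definition msupport (m : set natseq -> \bar R) : set natseq :=
  [set x | forall U : set {ptws nat -> nat}, open U -> U x -> (0 < m U)%E].

(* [mu w] need only be a measure for almost every w; its values outside the
   Borel sets are irrelevant. *)
Record random_probability (mu : Omega -> set natseq -> \bar R) : Prop := {
  rp_unit_interval :
    forall w B, measurable B -> (0 <= mu w B)%E /\ (mu w B <= 1)%E ;
  rp_measurable :
    forall B, measurable B -> measurable_fun setT (mu ^~ B) ;
  rp_ae : {ae P, forall w,
    (exists m : probability natseq R,
       forall B, measurable B -> mu w B = m B) /\
    msupport (mu w) = fibre w} }.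

(* L_omega^* (mu_(theta omega)) = mu_omega a.s.; nonnegative functions
   determine the measure on the left-hand side. *)
Definition ruelle_dual_invariant (phi : Omega -> natseq -> R)
    (mu : Omega -> set natseq -> \bar R) : Prop :=
  {ae P, forall w, forall f : natseq -> R,
    measurable_fun (fibre w) f -> (forall x, 0 <= f x) ->
    (\int[mu (theta w)]_(x in fibre (theta w)) ruelle phi w f x
     = \int[mu w]_(x in fibre w) (f x)%:E)%E}.

End chain.

(* Main.v *)
Require Import Defs.
From mathcomp Require Import all_boot all_order all_algebra finmap.
From mathcomp Require Import all_classical all_reals all_analysis.
From mathcomp Require Import measurable_realfun.
From mathcomp Require Import ring lra zify.
Import Order.TTheory GRing.Theory Num.Theory.
Import numFieldNormedType.Exports.
Local Open Scope classical_set_scope.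
Local Open Scope ring_scope.

(* Write mu_l for the fibre measure at theta^l(omega). The function u = f +
   D_omega(f) is a density with values in [0, 2 D_omega(f)], and lambda_l(E) is
   the integral of u over T^{-l} E. Since L_omega^* mu_{theta omega} = mu_omega
   and L_omega 1 = 1, the measures mu_l are the images of mu_0 under T^l, and
   Hoelder continuity of phi bounds the distortion of the inverse branches.
   Hence, on a cylinder [a] whose length j makes 2 r^j sum_k kappa(theta^{-k}
   omega) r^k small at time l, lambda_l is almost a constant multiple of mu_l.
   If moreover every symbol at time l + s receives at least a proportion eta of
   its mass from [a], then the width hi - lo of the best bounds lo mu_l <=
   lambda_l <= hi mu_l shrinks by a factor 1 - eta up to a small error. The
   times at which this happens are the visits of the orbit to a set G of base
   points, which has positive measure for suitable a, s, eta: big preimages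
   bound the proportion uniformly in the symbol at time l + s, and mixing
   connects [a] to the finite set of preimage symbols. By ergodicity almost
   every orbit visits G infinitely often in both directions of time, so that
   enough visits occur before some l_n(omega) (resp. in the last k_n(omega)
   steps) to make the width at most 2^{-n} D(f). Only the bound |lambda_l - D
   mu_l| <= 2^{-n} D mu_l is then needed. *)

Set Implicit Arguments.
Unset Strict Implicit.
Unset Printing Implicit Defensive.

(** * The space of sequences *)

(** Nothing is uniform in omega: only the positive part of log kappa has a finite integral, so the
    distortion accumulated along the past is finite almost surely but unbounded, and the first
    variation of phi is controlled only one step before the orbit meets the sets of big images or
    preimages. No rate per unit of time is sought: the random times are taken so late that the error
    is below 2^{-n}. The accuracy eps = 2^{-n}/32 is fixed before the contracting set, in the order:
    a bound M for the past distortion, the length j, and only then the word, s, eta and a second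
    bound M' for the distortion at the end of the window. These last data range over a countable set
    up to rounding, so some choice has positive probability; the set G changes with n. A cylinder of
    fixed length keeps some distortion, hence each visit leaves an error, but it enters with weight
    eta and the errors of all visits add up to O(eps) whatever their number. Comparing measures
    instead of densities makes the gain of a visit permanent, because the inequalities survive the
    shift. *)

Definition cyl (v : seq nat) : set natseq :=
  [set x | forall i, (i < size v)%N -> x i = nth 0%N v i].

Lemma open_coord (i : nat) (A : set nat) :
  open [set x : {ptws nat -> nat} | A (x i)].
Proof.
have /continuousP h : continuous (@proj nat (fun=> nat) i
    : {ptws nat -> nat} -> nat) by exact: proj_continuous.
by apply: h; exact: discrete_open.
Qed.

Lemma measurable_coord (i : nat) (A : set nat) :
  measurable [set x : natseq | A (x i)].
Proof. by apply: sub_sigma_algebra; exact: open_coord. Qed.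

Lemma open_cyl v : open (cyl v : set {ptws nat -> nat}).
Proof.
elim/last_ind: v => [|v c ih].
  by rewrite (_ : cyl [::] = setT); [exact: openT|apply/seteqP; split => x].
rewrite (_ : cyl (rcons v c) = cyl v `&`
    [set x : {ptws nat -> nat} | [set c] (x (size v))]); last first.
  apply/seteqP; split => x /= => [h|[h1 h2] i].
    split; last by have := h (size v); rewrite size_rcons nth_rcons ltnn eqxx; exact.
    move=> i si; have := h i; rewrite size_rcons nth_rcons si; apply.
    exact: ltnW.
  rewrite size_rcons ltnS leq_eqVlt nth_rcons => /orP[/eqP->|si].
    by rewrite ltnn eqxx.
  by rewrite si h1.
by apply: openI => //; exact: open_coord.
Qed.

Lemma measurable_cyl v : measurable (cyl v).
Proof. by apply: sub_sigma_algebra; exact: open_cyl. Qed.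

Lemma cyl_mkseq (x : natseq) n : cyl (mkseq x n) x.
Proof. by move=> i; rewrite size_mkseq => lin; rewrite nth_mkseq. Qed.

Lemma cyl_mkseqE (x y : natseq) n :
  cyl (mkseq x n) y <-> forall i, (i < n)%N -> y i = x i.
Proof.
by split=> [h i lin|h i]; [have := h i; rewrite size_mkseq nth_mkseq//; exact
  | rewrite size_mkseq => lin; rewrite nth_mkseq// h].
Qed.

Lemma cyl_cons c v : cyl (c :: v) = cyl [:: c] `&` shift_seq @^-1` cyl v.
Proof.
apply/seteqP; split => x /= => [h|[h1 h2] [|i]//= si].
  by split=> [[|]//= _|i si]; [exact: (h 0%N)|exact: (h i.+1)].
- exact: (h1 0%N).
- exact: h2.
Qed.

(** Otherwise points [y n] outside [U] agree with [x] up to [n] and converge to [x] pointwise. *)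
Lemma open_cyl_sub (U : set {ptws nat -> nat}) (x : natseq) :
  open U -> U x -> exists n, cyl (mkseq x n) `<=` U.
Proof.
move=> oU Ux; apply: contrapT => /forallNP h.
have {}h n : exists y : natseq, cyl (mkseq x n) y /\ ~ U y.
  by have /existsNP[y /not_implyP[? ?]] := h n; exists y.
have [y hy] := choice h.
have : {ptws, y @ \oo --> (x : nat -> nat)}.
  apply/pointwise_cvgP => t; apply: cvg_near_cst.
  exists t.+1 => //= n tn; have [/cyl_mkseqE + _] := hy n; exact.
move=> /(_ U); have nU : nbhs (x : {ptws nat -> nat}) U by exact: open_nbhs_nbhs.
move=> /(_ nU)[N _ /(_ N)/= /(_ (leqnn N))]; exact: (hy N).2.
Qed.

(** Words are countable: an arbitrary union of cylinders is re-indexed by their codes, a code of no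
    word of [S] giving the empty set. *)
Lemma cyl_bigcupE (S : set (seq nat)) : exists F : nat -> set natseq,
  (forall n, F n = set0 \/ exists2 v, S v & F n = cyl v) /\
  \bigcup_(v in S) cyl v = \bigcup_n F n.
Proof.
pose G (o : option (seq nat)) : set natseq :=
  if o is Some v then (if `[< S v >] then cyl v else set0) else set0.
exists (fun n => G (choice.unpickle n)); split.
  move=> n; rewrite /G; case: (choice.unpickle n) => [v|]; last by left.
  by case: asboolP => Sv; [right; exists v|left].
apply/seteqP; split => x [].
  by move=> v Sv vx; exists (choice.pickle v) => //; rewrite choice.pickleK /G asboolT.
move=> n _; rewrite /G; case: (choice.unpickle n) => // v.
by case: asboolP => // Sv vx; exists v.
Qed.

Lemma measurable_cyl_bigcup (S : set (seq nat)) :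
  measurable (\bigcup_(v in S) cyl v).
Proof.
have [F [FS ->]] := cyl_bigcupE S; apply: bigcupT_measurable => n.
by have [->|[v _ ->]] := FS n; [exact: measurable0|exact: measurable_cyl].
Qed.

(** A relatively open trace on [D] is cut out by the cylinders whose trace on [D] lies in [U]. The
    case [D = setT] gives the measurability of the shift, the case of a fibre that of Lipschitz
    functions. *)
Lemma measurable_cyl_union (U : set natseq) (D : set natseq) :
  (forall x, D x -> U x -> exists n, cyl (mkseq x n) `&` D `<=` U) ->
  exists2 V, measurable V & D `&` U = D `&` V.
Proof.
move=> h; pose S := [set v | cyl v `&` D `<=` U].
exists (\bigcup_(v in S) cyl v).
  exact: measurable_cyl_bigcup.
apply/seteqP; split=> x [Dx].
  move=> Ux; split => //; have [n hn] := h x Dx Ux.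
  by exists (mkseq x n) => //; exact: cyl_mkseq.
by move=> [v Sv vx]; split => //; exact: Sv.
Qed.

Lemma measurable_shift : measurable_fun setT shift_seq.
Proof.
apply: (@measurability _ _ _ _ setT shift_seq (@open {ptws nat -> nat})) => //.
move=> _ [U oU <-].
have [|V mV] := @measurable_cyl_union (shift_seq @^-1` U) setT.
  move=> x _ Ux; have [n hn] := open_cyl_sub oU Ux; exists n.+1.
  move=> y [/cyl_mkseqE hy _]; apply: hn; apply/cyl_mkseqE => i lin.
  by rewrite /shift_seq hy.
by move=> ->; rewrite setTI.
Qed.

Lemma measurable_iter_shift n : measurable_fun setT (iter n shift_seq).
Proof.
elim: n => [|n ih]; first exact: measurable_id.
by rewrite (_ : iter n.+1 _ = shift_seq \o iter n shift_seq)//;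
  apply: measurableT_comp => //; exact: measurable_shift.
Qed.

Lemma measurable_shift_preimage n E : measurable E ->
  measurable (iter n shift_seq @^-1` E).
Proof.
by move=> mE; rewrite -[X in measurable X]setTI; exact: measurable_iter_shift.
Qed.

Lemma iter_shiftE n (x : natseq) i : iter n shift_seq x i = x (n + i)%N.
Proof.
elim: n i => // n ih i.
by rewrite iterS /shift_seq ih addnS.
Qed.

(* The complement of the support is a countable union of null cylinders. *)
Lemma support_full (R : realType) (m : probability natseq R) :
  measurable (msupport m) -> m (msupport m) = 1%E.
Proof.
move=> mX; pose S := [set v | m (cyl v) = 0%E].
have Seq : ~` msupport m = \bigcup_(v in S) cyl v.
  apply/seteqP; split => x /=.
    move=> /existsNP[U /not_implyP[oU /not_implyP[Ux /negP]]].
    rewrite -leNgt => mU; have [n hn] := open_cyl_sub oU Ux.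
    exists (mkseq x n); last exact: cyl_mkseq.
    rewrite /S/=; apply/eqP; rewrite eq_le measure_ge0 andbT.
    apply: le_trans mU; apply: le_measure => //; rewrite inE; first exact: measurable_cyl.
    exact: sub_sigma_algebra.
  move=> [v Sv vx] /(_ (cyl v) (open_cyl v) vx).
  by rewrite Sv ltxx.
rewrite -[msupport m]setCK probability_setC ?measurableC// Seq; last exact: measurable_cyl_bigcup.
suff -> : m (\bigcup_(v in S) cyl v) = 0%E by rewrite sube0.
apply/negligibleP; first exact: measurable_cyl_bigcup.
have [F [FS ->]] := cyl_bigcupE S; apply: negligible_bigcup => n.
have [->|[v Sv ->]] := FS n; first exact: negligible_set0.
by apply/negligibleP => //; exact: measurable_cyl.
Qed.

(** * Integrals against set functions *)

Section integral_set_function.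
Import HBNNSimple.

(** Simple functions have measurable level sets, so an integral depends only on the values at
    measurable sets. This replaces the bare set function [mu w] by a genuine probability. *)
Lemma eq_integral_set_function d (T : measurableType d) (R : realType)
    (m1 m2 : set T -> \bar R) (D : set T) (f : T -> \bar R) :
  (forall B, measurable B -> m1 B = m2 B) ->
  (\int[m1]_(x in D) f x = \int[m2]_(x in D) f x)%E.
Proof.
move=> h; have E (g : {nnsfun T >-> R}) : sintegral m1 g = sintegral m2 g.
  by apply: eq_fsbigr => x _; rewrite h.
rewrite /integral; congr (_ - _)%E; congr ereal_sup; apply/seteqP;
  split => _ [g hg <-]; exists g => //.
Qed.

Lemma eq_integrand_set_function d (T : measurableType d) (R : realType)
    (m : set T -> \bar R) (D : set T) (f g : T -> \bar R) :
  {in D, f =1 g} -> (\int[m]_(x in D) f x = \int[m]_(x in D) g x)%E.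
Proof. by rewrite /integral => /eq_restrictP->. Qed.

End integral_set_function.

(** * Measurability of the fibres and of the total space *)

Section fibres.
Context d (Omega : measurableType d) (theta : Omega -> Omega).
Variables (W1 : Omega -> set nat) (alpha : Omega -> nat -> nat -> bool).
Local Notation X := (fibre theta W1 alpha).

Lemma measurable_coord2 i (A : nat -> nat -> Prop) :
  measurable [set x : natseq | A (x i) (x i.+1)].
Proof.
rewrite (_ : mkset _ = \bigcup_a ([set x : natseq | [set a] (x i)] `&`
    [set x : natseq | A a (x i.+1)])); last first.
  apply/seteqP; split => x /=; first by move=> h; exists (x i).
  by move=> [a _ [/= -> ]].
apply: bigcupT_measurable => a; apply: measurableI; first exact: measurable_coord.
exact: (measurable_coord i.+1 (A a)).
Qed.

Lemma measurable_fibre w : measurable (X w).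
Proof.
rewrite (_ : X w = \bigcap_i [set x : natseq |
    W1 (iter i theta w) (x i) /\ alpha (iter i theta w) (x i) (x i.+1)]).
  apply: bigcapT_measurable => i.
  exact: (measurable_coord2 i (fun a b =>
    W1 (iter i theta w) a /\ alpha (iter i theta w) a b)).
by apply/seteqP; split => x /= h i => [_|]; exact: h.
Qed.

Lemma fibre_shift w x : X w x -> X (theta w) (shift_seq x).
Proof. by move=> h i; rewrite -iterSr; exact: h. Qed.

Lemma fibre_iter_shift w n x :
  X w x -> X (iter n theta w) (iter n shift_seq x).
Proof. by move=> h; elim: n => // n; exact: fibre_shift. Qed.

Definition prepend (c : nat) (x : natseq) : natseq :=
  fun i => if i is j.+1 then x j else c.

Lemma prepend_shift c x : x 0%N = c -> prepend c (shift_seq x) = x.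
Proof. by move=> <-; apply/funext => -[]. Qed.

Lemma fibre_prepend w c x : X (theta w) x -> W1 w c -> alpha w c (x 0%N) ->
  X w (prepend c x).
Proof. by move=> h Wc ac [|i]//; rewrite iterSr; exact: h. Qed.

Hypothesis mtheta : measurable_fun setT theta.
Hypothesis mW1 : forall i, measurable [set w | W1 w i].
Hypothesis malpha : forall i j,
    measurable_fun [set w | W1 w i /\ W1 (theta w) j]
                   (fun w => alpha w i j).

Lemma measurable_iter n : measurable_fun setT (iter n theta).
Proof.
elim: n => [|n ih]; first exact: measurable_id.
by rewrite (_ : iter n.+1 _ = theta \o iter n theta)//; exact: measurableT_comp.
Qed.

Lemma measurable_iter_preimage n A : measurable A ->
  measurable (iter n theta @^-1` A).
Proof.
by move=> mA; rewrite -[X in measurable X]setTI; exact: measurable_iter.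
Qed.

Lemma measurable_total_space : measurable (total_space theta W1 alpha).
Proof.
(* Once the letters at positions [i] and [i.+1] are fixed, admissibility is a rectangle. *)
rewrite (_ : total_space _ _ _ = \bigcap_i \bigcup_a \bigcup_b
    ((iter i theta @^-1` ([set w | W1 w a /\ W1 (theta w) b] `&`
        (fun w => alpha w a b) @^-1` [set true])) `*`
     ([set x : natseq | [set a] (x i)] `&`
        [set x : natseq | [set b] (x i.+1)]))).
  apply: bigcapT_measurable => i; apply: bigcupT_measurable => a.
  apply: bigcupT_measurable => b; apply: measurableX.
    apply: measurable_iter_preimage; apply: malpha => //.
    apply: measurableI; first exact: mW1.
    exact: (measurable_iter_preimage 1 (mW1 b)).
  by apply: measurableI; exact: measurable_coord.
apply/seteqP; split => -[w x] h.
  move=> i _; exists (x i) => //; exists (x i.+1) => //; split => //=.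
  by have [Wi ai] := h i; have [Wi1 _] := h i.+1.
move=> i; have [a _ [b _ [[[Wa _] ab] [/= ha hb]]]] := h i I.
by rewrite ha hb.
Qed.

Lemma measurable_fun_fibre (R : realType) (f : Omega -> natseq -> R) w :
  measurable_on_X theta W1 alpha f -> measurable_fun (X w) (f w).
Proof.
move=> mf _ B mB; have := mf measurable_total_space B mB.
move=> /(measurable_xsection w); congr measurable.
by apply/seteqP; split => x; rewrite /xsection/= inE.
Qed.

End fibres.

(** * Transport of densities along one orbit *)

Lemma full_setI d (T : measurableType d) (R : realType) (n : probability T R)
    (X E : set T) :
  measurable X -> n X = 1%E -> measurable E -> n E = n (E `&` X).
Proof.
move=> mX X1 mE.
suff h : n (E `\` X) = 0%E.
  by apply: (eq_trans (measureDI n mE mX)); rewrite [X in (X + _)%E]h add0e.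
apply/eqP; rewrite eq_le measure_ge0 andbT.
have <- : n (~` X) = 0%E by rewrite probability_setC// X1 subee.
apply: le_measure; rewrite ?inE; [exact: measurableD|exact: measurableC|].
by move=> x [].
Qed.

Lemma fin_num_ge0P (R : realType) (x : \bar R) :
  x \is a fin_num -> (0 <= x)%E -> exists2 a, 0 <= a & x = a%:E.
Proof. by case: x => //= a _; rewrite lee_fin; exists a. Qed.

Lemma probability_EFin d (T : measurableType d) (R : realType)
    (n : probability T R) (E : set T) :
  measurable E -> exists2 a, 0 <= a & n E = a%:E.
Proof. by move=> mE; apply: fin_num_ge0P => //; exact: fin_num_measure. Qed.

Section transfer.
Context (R : realType) (m : nat -> probability natseq R).
Context (kap : nat -> R) (r : R).
Hypothesis invariant : forall i E, measurable E ->
  m i.+1 E = m i (shift_seq @^-1` E).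
(** Cross-multiplied form, meaningful for null sets, of the fact that the ratio of [m i] on the
    branch [c] to [m i.+1] varies little over [cyl b]. The power of [r] is the length of [c :: b];
    the 2 comes from comparing both sets with a common reference point. *)
Hypothesis distortion : forall i c b E E', (0 < size b)%N ->
  measurable E -> measurable E' -> E `<=` cyl b -> E' `<=` cyl b ->
  (m i (cyl [:: c] `&` shift_seq @^-1` E) * m i.+1 E' <=
   (expR (2 * (kap i * r ^+ (size b).+1)))%:E *
     (m i (cyl [:: c] `&` shift_seq @^-1` E') * m i.+1 E))%E.

Lemma invariant_iter i k E : measurable E ->
  m (i + k)%N E = m i (iter k shift_seq @^-1` E).
Proof.
move=> mE; elim: k E mE => [|k ih] E mE; first by rewrite addn0.
rewrite addnS invariant// ih//.
exact: (measurable_shift_preimage 1 mE).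
Qed.

Variables (X : set natseq) (u : natseq -> R) (B : R).
Hypotheses (mX : measurable X) (X1 : m 0%N X = 1%E).
Hypotheses (mu : measurable_fun setT u) (u0 : forall x, 0 <= u x).
Hypotheses (uB : forall x, u x <= B) (uX : forall x, ~ X x -> u x = 0).

(** In the application its density with respect to [m i] is the i-th iterate of the Ruelle operator
    at [u]; the measure itself is easier to handle. *)
Definition density_push (i : nat) (E : set natseq) : \bar R :=
  (\int[m 0%N]_(x in iter i shift_seq @^-1` E) (u x)%:E)%E.
Local Notation nu := density_push.

Lemma density_push_ge0 i E : (0 <= nu i E)%E.
Proof. by apply: integral_ge0 => x _; rewrite lee_fin. Qed.

Lemma measurable_fun_EFin_sub A : measurable A ->
  measurable_fun A (EFin \o u).
Proof.
by move=> mA; apply/measurable_EFinP; apply: measurable_funS mu.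
Qed.

Lemma density_push_le i E : measurable E -> (nu i E <= B%:E * m i E)%E.
Proof.
move=> mE; have mA := measurable_shift_preimage i mE.
rewrite -[i in m i]add0n invariant_iter// -integral_cst//.
apply: ge0_le_integral => //.
- by move=> x _; rewrite lee_fin.
- exact: measurable_fun_EFin_sub.
- by move=> x _; rewrite lee_fin.
Qed.

Lemma density_push_fin i E : measurable E -> nu i E \is a fin_num.
Proof.
move=> mE; rewrite ge0_fin_numE ?density_push_ge0//.
apply: (le_lt_trans (density_push_le i mE)).
by rewrite -ge0_fin_numE ?mule_ge0 ?lee_fin ?(le_trans (u0 point) (uB _))//;
  rewrite fin_numM// fin_num_measure.
Qed.

Lemma density_push_EFin i E : measurable E -> exists2 a, 0 <= a & nu i E = a%:E.
Proof.
by move=> mE; apply: fin_num_ge0P; [exact: density_push_fin|exact: density_push_ge0].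
Qed.

Lemma density_pushS i E : nu i.+1 E = nu i (shift_seq @^-1` E).
Proof. by []. Qed.

Lemma slices (E : set natseq) :
  E = \bigcup_c (cyl [:: c] `&` E) /\ trivIset setT (fun c => cyl [:: c] `&` E).
Proof.
split.
  apply/seteqP; split => x /=; last by move=> [c _ []].
  by move=> Ex; exists (x 0%N) => //; split => // -[].
apply/trivIsetP => c c' _ _ cc'; rewrite -subset0 => x [[h _] [h' _]].
by have := h 0%N isT; have := h' 0%N isT; move/eqP: cc' => cc' /= -> /esym.
Qed.

Lemma measure_slices (n : probability natseq R) (E : set natseq) :
  measurable E -> n E = (\sum_(c <oo) n (cyl [:: c] `&` E))%E.
Proof.
move=> mE; have [EE tE] := slices E; rewrite {1}EE measure_bigcup//=.
  by apply: eq_eseriesl => i; rewrite in_setT.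
by move=> c _; apply: measurableI => //; exact: measurable_cyl.
Qed.

Lemma density_push_slices i (E : set natseq) : measurable E ->
  nu i E = (\sum_(c <oo) nu i (cyl [:: c] `&` E))%E.
Proof.
move=> mE; have [EE tE] := slices E.
have mc c : measurable (cyl [:: c] `&` E).
  by apply: measurableI => //; exact: measurable_cyl.
rewrite /nu {1}EE preimage_bigcup ge0_integral_bigcup//.
- by move=> c; exact: measurable_shift_preimage.
- apply: measurable_fun_EFin_sub; apply: bigcupT_measurable => c.
  exact: measurable_shift_preimage.
- by move=> x _; rewrite lee_fin.
- apply/trivIsetP => c c' _ _ cc'; rewrite -preimage_setI.
  by move/trivIsetP : tE => /(_ c c' I I cc') ->; rewrite preimage_set0.
Qed.

Variables (l : nat) (del : R).
Hypothesis del0 : 0 <= del.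
Hypothesis osc : forall x y, X x -> X y ->
  (forall i, (i < l)%N -> x i = y i) -> `|u x - u y| <= del.

(** With a reference point [y0] of [E] in [X], the density on [X] is within [del] of [u y0] over
    both sets: one [del] is lost in bounding [nu 0 E] from above, one in bounding [nu 0 E'] from
    below. If [E] misses [X], its pushed mass vanishes. *)
Lemma density_push0 b E E' : (l <= size b)%N ->
  measurable E -> measurable E' -> E `<=` cyl b -> E' `<=` cyl b ->
  (nu 0 E * m 0%N E' <= (nu 0 E' + (2 * del)%:E * m 0%N E') * m 0%N E)%E.
Proof.
move=> lb mE mE' Eb E'b; have [[y0 [Ey Xy]]|] := pselect (E `&` X !=set0); last first.
  move=> EX; rewrite {1}/density_push integral0_eq ?mul0e.
    by rewrite mule_ge0// adde_ge0 ?density_push_ge0// mule_ge0// lee_fin mulr_ge0.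
  move=> x Ex; rewrite uX// => Xx; apply: EX; by exists x.
have agree x : (E `|` E') x -> X x -> `|u x - u y0| <= del.
  move=> Hx Xx; apply: osc => // i il.
  have ib : (i < size b)%N by exact: leq_trans lb.
  by rewrite (Eb _ Ey i ib); case: Hx => [/Eb|/E'b]; exact.
have h1 : (nu 0 E <= (u y0 + del)%:E * m 0%N E)%E.
  rewrite /nu/= -integral_cst//; apply: ge0_le_integral => //.
  - by move=> x _; rewrite lee_fin.
  - exact: measurable_fun_EFin_sub.
  - move=> x Ex; rewrite lee_fin.
    have [Xx|Xx] := pselect (X x); last by rewrite uX// addr_ge0.
    by have := agree x (or_introl Ex) Xx; rewrite ler_norml; lra.
have h2 : ((u y0)%:E * m 0%N E' <= nu 0 E' + del%:E * m 0%N E')%E.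
  rewrite (full_setI mX X1 mE') -integral_cst//; last exact: measurableI.
  apply: (@le_trans _ _ (\int[m 0%N]_(x in E' `&` X) ((u x)%:E + del%:E))%E).
    apply: ge0_le_integral => //.
    - exact: measurableI.
    - by move=> x _; rewrite lee_fin.
    - apply: emeasurable_funD => //.
      by apply: measurable_fun_EFin_sub; exact: measurableI.
    - move=> x [E'x Xx]; rewrite -EFinD lee_fin.
      by have := agree x (or_intror E'x) Xx; rewrite ler_norml; lra.
  have mEX := measurableI _ _ mE' mX.
  have mfEX := measurable_fun_EFin_sub mEX.
  rewrite ge0_integralD//=; last by move=> x _; rewrite lee_fin.
  rewrite integral_cst//.
  apply: leeD => //; apply: ge0_subset_integral => //.
  - exact: measurable_fun_EFin_sub.
  - by move=> x _; rewrite lee_fin.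
have [a a0 aE] := density_push_EFin 0 mE.
have [a' a'0 a'E] := density_push_EFin 0 mE'.
have [e e0 eE] := probability_EFin (m 0%N) mE.
have [e' e'0 e'E] := probability_EFin (m 0%N) mE'.
move: h1 h2; rewrite aE a'E eE e'E -!(EFinM, EFinD) !lee_fin => h1 h2.
have := ler_wpM2r e'0 h1; have := ler_wpM2l e0 h2; nra.
Qed.

(** A cylinder of length [j] at time [i] pulls back to cylinders of length [j + i - k] at time [k];
    the summand is the distortion paid in the step from [k] to [k.+1]. *)
Definition transfer_exponent i j : R := \sum_(k < i) kap k * r ^+ (j + i - k).

(* Pushing one symbol forward: the estimate for a cylinder [b] follows by
   summation from the estimates for the cylinders [c b]. *)
Lemma density_push_transfer i b E E' : (0 < size b)%N -> (l <= size b + i)%N ->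
  measurable E -> measurable E' -> E `<=` cyl b -> E' `<=` cyl b ->
  (nu i E * m i E' <= (expR (2 * transfer_exponent i (size b)))%:E *
     ((nu i E' + (2 * del)%:E * m i E') * m i E))%E.
Proof.
elim: i b E E' => [|i ih] b E E' b0 lb mE mE' Eb E'b.
  rewrite /transfer_exponent big_ord0 mulr0 expR0 mul1e.
  by apply: (@density_push0 b) => //; rewrite -(addn0 (size b)).
pose sl c (A : set natseq) := cyl [:: c] `&` shift_seq @^-1` A.
have msl c A : measurable A -> measurable (sl c A).
  move=> mA; apply: measurableI; first exact: measurable_cyl.
  exact: (measurable_shift_preimage 1 mA).
have slb c A : A `<=` cyl b -> sl c A `<=` cyl (c :: b).
  by move=> Ab; rewrite cyl_cons => x [cx /Ab].
pose C := expR (2 * transfer_exponent i.+1 (size b)).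
have step c : (nu i (sl c E) * m i.+1 E' <=
    C%:E * ((nu i (sl c E') + (2 * del)%:E * m i (sl c E')) * m i.+1 E))%E.
  have := ih (c :: b) (sl c E) (sl c E') isT.
  rewrite /= addSnnS => /(_ lb (msl c _ mE) (msl c _ mE') (slb c _ Eb) (slb c _ E'b)).
  have := distortion i c b0 mE mE' Eb E'b.
  have := distortion i c b0 mE' mE E'b Eb.
  have := density_push_le i (msl c _ mE).
  rewrite -/(sl c E) -/(sl c E').
  rewrite (_ : C = expR (2 * transfer_exponent i (size b).+1) *
                   expR (2 * (kap i * r ^+ (size b).+1))); last first.
    rewrite /C -expRD -mulrDr /transfer_exponent big_ord_recr/= addSnnS.
    by rewrite -addnBA// subSnn addn1.
  have [x x0 ->] := density_push_EFin i (msl c _ mE).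
  have [x' x'0 ->] := density_push_EFin i (msl c _ mE').
  have [y y0 ->] := probability_EFin (m i) (msl c _ mE).
  have [y' y'0 ->] := probability_EFin (m i) (msl c _ mE').
  have [z z0 ->] := probability_EFin (m i.+1) mE.
  have [z' z'0 ->] := probability_EFin (m i.+1) mE'.
  rewrite -!(EFinM, EFinD) !lee_fin.
  have := expR_gt0 (2 * transfer_exponent i (size b).+1).
  have := expR_gt0 (2 * (kap i * r ^+ (size b).+1)).
  move: (expR (2 * transfer_exponent i (size b).+1)).
  move: (expR (2 * (kap i * r ^+ (size b).+1))).
  move=> D' C' D0 C0 xB h1 h2 h3.
  have [y'p|] := ltP 0 y'.
    rewrite -(ler_pM2r y'p).
    have s1 := ler_wpM2r z'0 h3.
    have w0 : 0 <= C' * (x' + 2 * del * y').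
      by rewrite mulr_ge0 ?addr_ge0 ?mulr_ge0// ltW.
    have s2 := ler_wpM2l w0 h2.
    apply: (le_trans (y := x * y' * z')); first by lra.
    apply: (le_trans s1); apply: (le_trans (y := C' * (x' + 2 * del * y') * (y * z'))).
      by lra.
    by apply: (le_trans s2); lra.
  (* A null [y'] cannot be cancelled; then [h2] gives [y * z' = 0], and [x * z' = 0] because [x] is
     at most [B * y]. *)
  move=> y'le; have y'E : y' = 0 by apply/eqP; rewrite eq_le y'le.
  have : 0 <= C' * D' * ((x' + 2 * del * y') * z).
    by rewrite !mulr_ge0 ?addr_ge0 ?mulr_ge0// ltW.
  apply: le_trans.
  have : y * z' <= 0 by move: h2; rewrite y'E mul0r mulr0.
  rewrite le_eqVlt ltNge mulr_ge0// orbF mulf_eq0 => /orP[]/eqP e0.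
    by move: xB; rewrite e0 mulr0 => xB; nra.
  by rewrite e0 mulr0.
have shiftE A : measurable A -> m i.+1 A = (\sum_(c <oo) m i (sl c A))%E.
  by move=> mA; rewrite invariant// measure_slices//; exact: (measurable_shift_preimage 1 mA).
have nuE A : measurable A -> nu i.+1 A = (\sum_(c <oo) nu i (sl c A))%E.
  move=> mA; rewrite density_pushS density_push_slices//.
  exact: (measurable_shift_preimage 1 mA).
have [z z0 zf] := probability_EFin (m i.+1) mE.
have [z' z'0 z'f] := probability_EFin (m i.+1) mE'.
rewrite nuE// [in X in (X <= _)%E]z'f muleC -nneseriesZl; last first.
  by move=> c _; exact: density_push_ge0.
rewrite [in X in (_ <= X)%E]nuE// [in X in (_ + _ * X)%E]shiftE//.
rewrite -nneseriesZl; last by [].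
rewrite -nneseriesD; last 2 first.
  by move=> c _ _; exact: density_push_ge0.
  by move=> c _ _; rewrite mule_ge0// lee_fin mulr_ge0.
rewrite -/C zf [X in (_ * X)%E]muleC muleA -EFinM -nneseriesZl; last first.
  by move=> c _; rewrite adde_ge0 ?density_push_ge0// mule_ge0// lee_fin mulr_ge0.
apply: lee_nneseries => c _.
  by rewrite mule_ge0 ?density_push_ge0// lee_fin.
rewrite muleC -z'f; apply: (le_trans (step c)).
by rewrite zf [(C * z)%:E]EFinM -muleA [X in (_ * X <= _)%E]muleC.
Qed.

Lemma density_push_iter i k E :
  nu (i + k) E = nu i (iter k shift_seq @^-1` E).
Proof.
rewrite /density_push (_ : _ @^-1` E = iter i shift_seq @^-1` (iter k shift_seq @^-1` E))//.
by apply/seteqP; split => x; rewrite /preimage/= addnC iterD.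
Qed.

Lemma density_push_split i E A : measurable E -> measurable A ->
  nu i E = (nu i (A `&` E) + nu i (E `\` A))%E.
Proof.
move=> mE mA; have mAE := measurableI _ _ mA mE; have mD := measurableD mE mA.
rewrite /density_push -ge0_integral_setU; last 5 first.
- exact: measurable_shift_preimage.
- exact: measurable_shift_preimage.
- apply: measurable_fun_EFin_sub.
  by apply: measurableU; exact: measurable_shift_preimage.
- by move=> x _; rewrite lee_fin.
- by apply/disj_setPS => x [[/= Ax _] [_ /= /(_ Ax)]].
by rewrite -preimage_setU setIC setUIDK.
Qed.

Definition sandwich i (lo hi : R) := forall E, measurable E ->
  (lo%:E * m i E <= nu i E)%E /\ (nu i E <= hi%:E * m i E)%E.

Lemma sandwich0 : sandwich 0 0 B.
Proof.
move=> E mE; rewrite mul0e density_push_ge0; split => //.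
exact: (density_push_le 0 mE).
Qed.

(** Inequalities between measures pass to image measures, so no width is lost between visits. *)
Lemma sandwichS i lo hi : sandwich i lo hi -> sandwich i.+1 lo hi.
Proof.
move=> h E mE; rewrite invariant// density_pushS; apply: h.
exact: (measurable_shift_preimage 1 mE).
Qed.

Lemma sandwich_leq i k lo hi : (i <= k)%N ->
  sandwich i lo hi -> sandwich k lo hi.
Proof.
by move=> /subnKC <-; elim: (k - i)%N => [|n ih]; rewrite ?addn0// addnS => /ih/sandwichS.
Qed.

(* On a cylinder [a] of small distortion the pushed density is within [eps] of
   its mean, and a proportion [eta] of the mass at time [i + s] comes from [a]. *)
Lemma sandwich_contraction i s a (eta eps lo hi : R) :
  (l <= i)%N -> (0 < size a)%N -> 0 < eta -> 0 <= eps <= 1 ->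
  expR (2 * transfer_exponent i (size a)) <= 1 + eps -> del <= B * eps ->
  (forall E, measurable E ->
    eta%:E * m (i + s)%N E <= m i (cyl a `&` iter s shift_seq @^-1` E))%E ->
  sandwich i lo hi ->
  exists lo' hi', sandwich (i + s) lo' hi' /\
    hi' - lo' <= (1 - eta) * (hi - lo) + eta * (8 * B * eps).
Proof.
move=> li a0 eta0 /andP[eps0 eps1] ea delB big_a sand.
have mA := measurable_cyl a.
have B0 : 0 <= B by exact: le_trans (u0 point) (uB _).
have [al al0 alE] := probability_EFin (m i) mA.
have alp : 0 < al.
  apply: (lt_le_trans eta0); rewrite -lee_fin -alE -[eta%:E]mule1.
  rewrite -(@probability_setT _ _ _ (m (i + s)%N)).
  apply: (le_trans (big_a _ measurableT)).
  by rewrite preimage_setT setIT.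
have [la la0 laE] := density_push_EFin i mA.
(* The mean density of the pushed measure on [cyl a]. *)
pose rho := la / al.
have laB : rho <= B.
  rewrite ler_pdivrMr//; have := density_push_le i mA.
  by rewrite laE alE -EFinM lee_fin.
have rho0 : 0 <= rho by rewrite divr_ge0.
have laR : la = rho * al by rewrite /rho divfK// gt_eqF.
clearbody rho.
have inA E : measurable E -> E `<=` cyl a ->
    (((rho * (1 - eps) - 2 * del)%:E * m i E <= nu i E) /\
     (nu i E <= ((1 + eps) * (rho + 2 * del))%:E * m i E))%E.
  move=> mE Ea; have lai : (l <= size a + i)%N by rewrite (leq_trans li)// leq_addl.
  have := density_push_transfer a0 lai mE mA Ea (@subset_refl _ _).
  have := density_push_transfer a0 lai mA mE (@subset_refl _ _) Ea.
  rewrite laE alE; have [x x0 ->] := density_push_EFin i mE.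
  have [y y0 ->] := probability_EFin (m i) mE.
  rewrite -!(EFinM, EFinD) !lee_fin laR.
  move: ea; set e := expR _ => ea h1 h2.
  have w1 : 0 <= (x + 2 * del * y) * al by rewrite !(mulr_ge0, addr_ge0)// ltW.
  have w2 : 0 <= (rho * al + 2 * del * al) * y by rewrite !(mulr_ge0, addr_ge0).
  have {}h1 := le_trans h1 (ler_wpM2r w1 ea).
  have {}h2 := le_trans h2 (ler_wpM2r w2 ea).
  split; last by rewrite -(ler_pM2r alp); apply: (le_trans h2); lra.
  have h3 : rho * y <= (1 + eps) * (x + 2 * del * y).
    by rewrite -(ler_pM2r alp); move: h1; lra.
  (* Multiplying by [1 - eps] turns the factor [1 + eps] into [1 - eps * eps], which is at most 1;
     [h5] is the difference. *)
  have h4 : (1 - eps) * (rho * y) <= (1 - eps) * ((1 + eps) * (x + 2 * del * y)).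
    by apply: ler_wpM2l => //; rewrite subr_ge0.
  have h5 : 0 <= eps * eps * (x + 2 * del * y) by rewrite !(mulr_ge0, addr_ge0).
  lra.
pose rp := (1 + eps) * (rho + 2 * del); pose rm := rho * (1 - eps) - 2 * del.
(* Averages, with weight [eta], of the old bounds and of those valid on [cyl a]. *)
exists (lo + eta * (rm - lo)), (hi - eta * (hi - rp)); split; last first.
  (* The difference is [2 * rho * eps + 4 * del + 2 * eps * del], where [rho <= B] and
     [del <= B * eps]. *)
  have : rp - rm <= 8 * B * eps.
    have : rho * eps <= B * eps by exact: ler_wpM2r.
    have : eps * del <= del by rewrite ler_piMl.
    rewrite /rp /rm; lra.
  move=> /(ler_wpM2l (ltW eta0)); lra.
move=> E mE; have mF := measurable_shift_preimage s mE.
have mAF := measurableI _ _ mA mF; have mD := measurableD mF mA.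
have [qlo qhi] := inA _ mAF (@subIsetl _ _ _).
have [dlo dhi] := sand _ mD; have [flo fhi] := sand _ mF.
have big_E := big_a _ mE.
rewrite density_push_iter invariant_iter//.
rewrite invariant_iter// in big_E.
rewrite (density_push_split i mF mA).
rewrite (density_push_split i mF mA) in flo fhi.
have mS : m i (iter s shift_seq @^-1` E) = (m i (cyl a `&` iter s shift_seq @^-1` E) +
    m i (iter s shift_seq @^-1` E `\` cyl a))%E.
  by apply: (eq_trans (measureDI (m i) mF mA)); rewrite addeC setIC.
move: qlo qhi dlo dhi flo fhi big_E; rewrite mS.
have [x x0 ->] := density_push_EFin i mAF.
have [x' x'0 ->] := density_push_EFin i mD.
have [q q0 ->] := probability_EFin (m i) mAF.
have [q' q'0 ->] := probability_EFin (m i) mD.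
rewrite -!(EFinM, EFinD) !lee_fin -/rp -/rm => qlo qhi dlo dhi flo fhi big_E.
split.
(* If [rm <= lo], the new bound is weaker than [flo]. Otherwise [rm] is used on the part in [cyl a],
   which has at least the proportion [eta] of the mass, and [lo] on the rest. *)
- have [le|/ltW le] := leP rm lo.
    have : 0 <= eta * (q + q') * (lo - rm).
      by apply: mulr_ge0; [apply: mulr_ge0; [exact: ltW|exact: addr_ge0]|rewrite subr_ge0].
    lra.
  have : (rm - lo) * (eta * (q + q')) <= (rm - lo) * q by rewrite ler_wpM2l ?subr_ge0.
  lra.
- have [le|/ltW le] := leP hi rp.
    have : 0 <= eta * (q + q') * (rp - hi).
      by apply: mulr_ge0; [apply: mulr_ge0; [exact: ltW|exact: addr_ge0]|rewrite subr_ge0].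
    lra.
  have : (hi - rp) * (eta * (q + q')) <= (hi - rp) * q by rewrite ler_wpM2l ?subr_ge0.
  lra.
Qed.

End transfer.

(** * From sets to test functions: weighted integrals *)

Section pairing_simple.
Import HBNNSimple.
Local Open Scope ereal_scope.

Lemma integral_weighted_simple d d' (T : measurableType d) (T' : measurableType d')
    (R : realType) (m : {measure set T -> \bar R}) (u : T -> R) (S : T -> T')
    (g : {nnsfun T' >-> R}) :
  measurable_fun setT u -> (forall x, (0 <= u x)%R) -> measurable_fun setT S ->
  \int[m]_x (u x * g (S x))%:E =
  \sum_(i < #|` fset_set (g @` setT)|) ((fset_set (g @` setT))`_i)%:E *
    \int[m]_(x in S @^-1` (g @^-1` [set (fset_set (g @` setT))`_i])) (u x)%:E.
Proof.
move=> mu u0 mS; set s := fset_set _.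
have mA a : measurable (S @^-1` (g @^-1` [set a])).
  by rewrite -[X in measurable X]setTI; exact: mS.
have mui a : measurable_fun setT (fun x => (u x * \1_(g @^-1` [set a]) (S x))%:E).
  apply/measurable_EFinP; apply: measurable_funM => //.
  by apply: (measurableT_comp _ mS); exact: measurable_indic.
have s0 i : (i < #|` s|)%N -> (0 <= s`_i)%R.
  move=> si; have : s`_i \in (s : seq R) by rewrite mem_nth.
  by rewrite in_fset_set//= inE => -[x _ <-].
under eq_integral => x _.
  rewrite (fimfunEord g) -/s mulr_sumr -sumEFin.
  under eq_bigr => i _ do rewrite mulrCA EFinM.
  over.
rewrite ge0_integral_sum//; last 2 first.
- move=> i; apply: emeasurable_funM => //.
- by move=> i x _; apply: mule_ge0; rewrite lee_fin ?mulr_ge0//; exact: s0.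
apply: eq_bigr => i _; rewrite ge0_integralZl_EFin//; last 2 first.
- by move=> x _; rewrite lee_fin mulr_ge0.
- exact: s0.
congr (_ * _); rewrite [RHS]integral_mkcond; apply: eq_integral => x _.
rewrite patchE indicE; case: ifPn => /=.
  by rewrite inE /= => h; rewrite mem_set// mulr1.
by rewrite notin_setE /= => h; rewrite memNset// mulr0.
Qed.

(** The inequality extends from sets to simple functions and then to [h] by monotone convergence.
    Two spaces and two weights are allowed so that one side can be the image measure, with the
    identity map and a constant weight. *)
Lemma le_integral_weighted d1 d2 d' (T1 : measurableType d1)
    (T2 : measurableType d2) (T' : measurableType d') (R : realType)
    (m1 : {measure set T1 -> \bar R}) (m2 : {measure set T2 -> \bar R})
    (u1 : T1 -> R) (u2 : T2 -> R) (S1 : T1 -> T') (S2 : T2 -> T') (h : T' -> R) :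
  measurable_fun setT u1 -> (forall x, (0 <= u1 x)%R) -> measurable_fun setT S1 ->
  measurable_fun setT u2 -> (forall x, (0 <= u2 x)%R) -> measurable_fun setT S2 ->
  measurable_fun setT h -> (forall x, (0 <= h x)%R) ->
  (forall A, measurable A -> \int[m1]_(x in S1 @^-1` A) (u1 x)%:E <=
                             \int[m2]_(x in S2 @^-1` A) (u2 x)%:E) ->
  \int[m1]_x (u1 x * h (S1 x))%:E <= \int[m2]_x (u2 x * h (S2 x))%:E.
Proof.
move=> mu1 u10 mS1 mu2 u20 mS2 mh h0 le12.
have mh' : measurable_fun setT (EFin \o h) by exact/measurable_EFinP.
pose g := nnsfun_approx measurableT mh'.
have gh n x : (g n x <= h x)%R.
  rewrite -lee_fin /g nnsfun_approxE (@le_approx _ _ _ setT (EFin \o h))//.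
  by move=> y _; rewrite lee_fin.
have mgS n : measurable_fun setT (fun x => u1 x * g n (S1 x))%R.
  by apply: measurable_funM => //; apply: measurableT_comp.
have -> : \int[m1]_x (u1 x * h (S1 x))%:E =
    limn (fun n => \int[m1]_x (u1 x * g n (S1 x))%:E).
  rewrite -monotone_convergence//.
  - apply: eq_integral => x _; apply/esym/cvg_lim => //.
    rewrite EFinM; under eq_fun do rewrite EFinM.
    apply: cvgeZl => //.
    by apply: cvg_nnsfun_approx => // y _; rewrite lee_fin.
  - by move=> n; exact/measurable_EFinP.
  - by move=> n x _; rewrite lee_fin mulr_ge0.
  - move=> x _ a b ab; rewrite lee_fin ler_wpM2l//.
    exact/lefP/nd_nnsfun_approx.
apply: lime_le.
  apply: ereal_nondecreasing_is_cvgn => a b ab; apply: ge0_le_integral => //.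
  - by move=> x _; rewrite lee_fin mulr_ge0.
  - exact/measurable_EFinP.
  - exact/measurable_EFinP.
  - move=> x _; rewrite lee_fin ler_wpM2l//.
    exact/lefP/nd_nnsfun_approx.
near=> n; apply: (@le_trans _ _ (\int[m2]_x (u2 x * g n (S2 x))%:E)).
  rewrite !integral_weighted_simple//; apply: lee_sum => i _.
  apply: lee_wpmul2l; last first.
    by apply: le12; rewrite -[X in measurable X]setTI; exact: measurable_funP.
  set s := fset_set _.
  have : s`_i \in (s : seq R) by rewrite mem_nth.
  by rewrite in_fset_set//= inE lee_fin => -[x _ <-].
apply: ge0_le_integral => //.
- by move=> x _; rewrite lee_fin mulr_ge0.
- by apply/measurable_EFinP/measurable_funM => //; apply: measurableT_comp.
- by apply/measurable_EFinP/measurable_funM => //; apply: measurableT_comp.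
- by move=> x _; rewrite lee_fin ler_wpM2l.
Unshelve. all: by end_near.
Qed.

End pairing_simple.

Lemma integral_full d (T : measurableType d) (R : realType)
    (m : probability T R) (X : set T) (f : T -> R) :
  measurable X -> m X = 1%E -> measurable_fun setT f -> (forall x, 0 <= f x) ->
  (\int[m]_(x in X) (f x)%:E = \int[m]_x (f x)%:E)%E.
Proof.
move=> mX X1 mf f0; have mC := measurableC mX.
rewrite [RHS](@ge0_negligible_integral _ _ _ _ _ (~` X))//.
- by rewrite setTD setCK.
- exact/measurable_EFinP.
- by move=> x _; rewrite lee_fin.
- by apply: (eq_trans (probability_setC m mX)); rewrite [X in (_ - X)%E]X1 subee.
Qed.

Lemma integral_EFin_cst d (T : measurableType d) (R : realType)
    (m : {measure set T -> \bar R}) (A : set T) (c : R) :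
  measurable A -> (\int[m]_(x in A) (cst c x)%:E = c%:E * m A)%E.
Proof. by move=> mA; exact: (integral_cst m mA c%:E). Qed.

Section pairing.
Context d1 d2 (T1 : measurableType d1) (T2 : measurableType d2) (R : realType).
Context (m1 : probability T1 R) (m2 : probability T2 R) (S : T1 -> T2).
Context (u : T1 -> R) (lo hi D : R).
Hypothesis mS : measurable_fun setT S.
Hypothesis m12 : forall A, measurable A -> m2 A = m1 (S @^-1` A).
Hypotheses (mu : measurable_fun setT u) (u0 : forall x, 0 <= u x).
Hypotheses (lo0 : 0 <= lo) (loD : lo <= D) (Dhi : D <= hi).
Hypothesis sand : forall A, measurable A ->
  (lo%:E * m2 A <= \int[m1]_(x in S @^-1` A) (u x)%:E)%E /\
  (\int[m1]_(x in S @^-1` A) (u x)%:E <= hi%:E * m2 A)%E.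

Lemma weighted_sandwich (h : T2 -> R) :
  measurable_fun setT h -> (forall x, 0 <= h x) ->
  [/\ (lo%:E * \int[m2]_x (h x)%:E <= \int[m1]_x (u x * h (S x))%:E)%E,
     (\int[m1]_x (u x * h (S x))%:E <= hi%:E * \int[m2]_x (h x)%:E)%E &
     (\int[m1]_x (D * h (S x))%:E = D%:E * \int[m2]_x (h x)%:E)%E].
Proof.
move=> mh h0; have D0 := le_trans lo0 loD; have hi0 := le_trans D0 Dhi.
have cstE c : 0 <= c ->
    (c%:E * \int[m2]_x (h x)%:E = \int[m2]_x ((cst c) x * h (id x))%:E)%E.
  move=> c0; rewrite -ge0_integralZl_EFin//; last exact/measurable_EFinP.
  by move=> x _; rewrite lee_fin.
have mpre A : measurable A -> measurable (S @^-1` A).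
  by move=> mA; rewrite -[X in measurable X]setTI; exact: mS.
rewrite !cstE//; split.
- apply: le_integral_weighted => // A mA.
  by rewrite preimage_id integral_EFin_cst//; exact: (sand mA).1.
- apply: le_integral_weighted => // A mA.
  by rewrite preimage_id integral_EFin_cst//; exact: (sand mA).2.
- have cE A : measurable A -> (\int[m1]_(x in S @^-1` A) (cst D x)%:E =
      \int[m2]_(x in id @^-1` A) (cst D x)%:E)%E.
    move=> mA; rewrite preimage_id !integral_EFin_cst//; last exact: mpre.
    by congr (_ * _)%E; exact/esym/m12.
  apply/eqP; rewrite eq_le; apply/andP; split;
  by apply: (@le_integral_weighted _ _ _ _ _ _ _ _ _ (cst D) (cst D)) => // A mA;
    rewrite cE.
Qed.

Variables (X : set T1) (Y : set T2) (f : T1 -> R) (g : T2 -> R).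
Hypotheses (mX : measurable X) (X1 : m1 X = 1%E).
Hypotheses (mY : measurable Y) (XY : forall x, X x -> Y (S x)).
Hypothesis fu : forall x, X x -> f x = u x - D.
Hypothesis mg : measurable_fun Y g.
Hypothesis gfin : (\int[m2]_(x in Y) `|g x|%:E < +oo)%E.

Lemma pairing_bound :
  (`| \int[m1]_(x in X) (f x * g (S x))%:E | <=
   (hi - lo)%:E * \int[m2]_(x in Y) `|g x|%:E)%E.
Proof.
have D0 := le_trans lo0 loD; have hi0 := le_trans D0 Dhi.
pose gY := g \_ Y.
have mgY : measurable_fun setT gY by exact/(measurable_restrictT _ mY).
pose gp y := (`|gY y| + gY y) / 2; pose gn y := (`|gY y| - gY y) / 2.
have gp0 y : 0 <= gp y by rewrite /gp; have := ler_norm (- gY y); rewrite normrN; lra.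
have gn0 y : 0 <= gn y by rewrite /gn; have := ler_norm (gY y); lra.
have mn : measurable_fun setT (fun y => `|gY y|) by exact: measurableT_comp.
have mgp : measurable_fun setT gp.
  by apply: measurable_funM => //; exact: measurable_funD.
have mgn : measurable_fun setT gn.
  by apply: measurable_funM => //; exact: measurable_funB.
have pn : (\int[m2]_(x in Y) `|g x|%:E =
    \int[m2]_x (gp x)%:E + \int[m2]_x (gn x)%:E)%E.
  rewrite -ge0_integralD//; last 4 first.
  - by move=> x _; rewrite lee_fin.
  - exact/measurable_EFinP.
  - by move=> x _; rewrite lee_fin.
  - exact/measurable_EFinP.
  rewrite [LHS]integral_mkcond; apply: eq_integral => x _.
  rewrite -EFinD patchE /gp /gn /gY patchE; case: ifPn => _.
    by congr EFin; lra.
  by congr EFin; rewrite normr0; lra.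
have ip0 : (0 <= \int[m2]_x (gp x)%:E)%E by apply: integral_ge0 => x _; rewrite lee_fin.
have in0 : (0 <= \int[m2]_x (gn x)%:E)%E by apply: integral_ge0 => x _; rewrite lee_fin.
have [p p0 pE] : exists2 p, 0 <= p & (\int[m2]_x (gp x)%:E = p%:E)%E.
  apply: fin_num_ge0P => //; rewrite ge0_fin_numE//.
  by apply: le_lt_trans gfin; rewrite pn leeDl.
have [n n0 nE] : exists2 n, 0 <= n & (\int[m2]_x (gn x)%:E = n%:E)%E.
  apply: fin_num_ge0P => //; rewrite ge0_fin_numE//.
  by apply: le_lt_trans gfin; rewrite pn leeDr.
have [p1 p2 p3] := weighted_sandwich mgp gp0.
have [n1 n2 n3] := weighted_sandwich mgn gn0.
rewrite pn pE nE.
move: p1 p2 p3 n1 n2 n3; rewrite pE nE -!EFinM => p1 p2 p3 n1 n2 n3.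
have ug0 h : (forall y : T2, 0 <= h y) -> (0 <= \int[m1]_x (u x * h (S x))%:E)%E.
  by move=> h0; apply: integral_ge0 => x _; rewrite lee_fin mulr_ge0.
have [Up Up0 UpE] : exists2 a, 0 <= a & (\int[m1]_x (u x * gp (S x))%:E = a%:E)%E.
  apply: fin_num_ge0P (ug0 _ gp0); rewrite ge0_fin_numE ?ug0//.
  exact: (le_lt_trans p2 (ltry _)).
have [Un Un0 UnE] : exists2 a, 0 <= a & (\int[m1]_x (u x * gn (S x))%:E = a%:E)%E.
  apply: fin_num_ge0P (ug0 _ gn0); rewrite ge0_fin_numE ?ug0//.
  exact: (le_lt_trans n2 (ltry _)).
move: p1 p2 n1 n2; rewrite UpE UnE !lee_fin => p1 p2 n1 n2.
have mgpS : measurable_fun setT (gp \o S) by exact: measurableT_comp.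
have mgnS : measurable_fun setT (gn \o S) by exact: measurableT_comp.
have mugp : measurable_fun setT (fun x => u x * gp (S x)) by exact: measurable_funM.
have mugn : measurable_fun setT (fun x => u x * gn (S x)) by exact: measurable_funM.
have mDgp : measurable_fun setT (fun x => D * gp (S x)) by exact: measurable_funM.
have mDgn : measurable_fun setT (fun x => D * gn (S x)) by exact: measurable_funM.
(* On [X] the integrand [f x * g (S x)] is [a x - b x], both nonnegative with finite integral. The
   result is [(Up - D * p) - (Un - D * n)], and [lo <= D <= hi] bounds the two brackets by [hi - lo]
   times [p] and [n]. *)
pose a x := u x * gp (S x) + D * gn (S x).
pose b x := u x * gn (S x) + D * gp (S x).
have a0 x : 0 <= a x by rewrite addr_ge0// mulr_ge0.
have b0 x : 0 <= b x by rewrite addr_ge0// mulr_ge0.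
have ma : measurable_fun setT a by exact: measurable_funD.
have mb : measurable_fun setT b by exact: measurable_funD.
have aE : (\int[m1]_x (a x)%:E = (Up + D * n)%:E)%E.
  rewrite /a; under eq_integral do rewrite EFinD.
  rewrite ge0_integralD//; last 4 first.
  - by move=> x _; rewrite lee_fin mulr_ge0.
  - exact/measurable_EFinP.
  - by move=> x _; rewrite lee_fin mulr_ge0.
  - exact/measurable_EFinP.
  by rewrite UpE n3.
have bE : (\int[m1]_x (b x)%:E = (Un + D * p)%:E)%E.
  rewrite /b; under eq_integral do rewrite EFinD.
  rewrite ge0_integralD//; last 4 first.
  - by move=> x _; rewrite lee_fin mulr_ge0.
  - exact/measurable_EFinP.
  - by move=> x _; rewrite lee_fin mulr_ge0.
  - exact/measurable_EFinP.
  by rewrite UnE p3.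
have integ (c : T1 -> R) : measurable_fun setT c -> (forall x, 0 <= c x) ->
    (\int[m1]_x (c x)%:E < +oo)%E -> m1.-integrable X (EFin \o c).
  move=> mc c0 cfin; apply/integrableP; split.
    by apply/measurable_EFinP; apply: measurable_funS mc.
  apply: le_lt_trans cfin; rewrite -(integral_full mX X1 mc c0).
  by under eq_integral do rewrite /= ger0_norm//.
have -> : (\int[m1]_(x in X) (f x * g (S x))%:E =
    \int[m1]_(x in X) ((a x)%:E - (b x)%:E))%E.
  apply: eq_integral => x; rewrite inE => Xx; rewrite -EFinB; congr EFin.
  have -> : g (S x) = gp (S x) - gn (S x).
    by rewrite /gp /gn /gY patchE mem_set//; [lra|exact: XY].
  by rewrite fu// /a /b; ring.
have ia : m1.-integrable X (EFin \o a) by apply: integ; rewrite ?aE ?ltry.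
have ib : m1.-integrable X (EFin \o b) by apply: integ; rewrite ?bE ?ltry.
rewrite integralB_EFin//.
rewrite !integral_full// aE bE -EFinB abse_EFin lee_fin ler_norml.
have q1 : lo * p <= D * p by exact: ler_wpM2r.
have q2 : lo * n <= D * n by exact: ler_wpM2r.
have q3 : D * p <= hi * p by exact: ler_wpM2r.
have q4 : D * n <= hi * n by exact: ler_wpM2r.
apply/andP; split; lra.
Qed.

End pairing.

(** * The proportion of mass issuing from a word *)

Section cylinder_mass.
Context (R : realType) (m : nat -> probability natseq R).
Context (kap : nat -> R) (r : R).
Hypothesis invariant : forall i E, measurable E ->
  m i.+1 E = m i (shift_seq @^-1` E).
Hypothesis distortion : forall i c b E E', (0 < size b)%N ->
  measurable E -> measurable E' -> E `<=` cyl b -> E' `<=` cyl b ->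
  (m i (cyl [:: c] `&` shift_seq @^-1` E) * m i.+1 E' <=
   (expR (2 * (kap i * r ^+ (size b).+1)))%:E *
     (m i (cyl [:: c] `&` shift_seq @^-1` E') * m i.+1 E))%E.
Variables (a : seq nat) (s : nat).
Hypothesis as_ : (size a <= s)%N.
Local Notation q E := (m 0%N (cyl a `&` iter s shift_seq @^-1` E)).

(** The transfer estimate for the density [\1_(cyl a)]: the first [s] coordinates decide membership
    in [cyl a], so the oscillation is 0. *)
Lemma cylinder_mass_transfer b E E' : (0 < size b)%N ->
  measurable E -> measurable E' -> E `<=` cyl b -> E' `<=` cyl b ->
  (q E * m s E' <=
   (expR (2 * transfer_exponent kap r s (size b)))%:E * (q E' * m s E))%E.
Proof.
move=> b0 mE mE' Eb E'b.
have qE A : measurable A -> q A = density_push m \1_(cyl a) s A.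
  move=> mA; rewrite /density_push integral_indic//; last exact: measurable_cyl.
  exact: (measurable_shift_preimage s mA).
have := @density_push_transfer R m kap r invariant distortion setT \1_(cyl a) 1
  measurableT (probability_setT (m 0%N)) (measurable_indic (measurable_cyl a))
  _ _ _ s 0 _ _ s b E E' b0 _ mE mE' Eb E'b.
rewrite mulr0 mul0e adde0 -!qE//; apply => //.
- by move=> x h; exfalso; exact: h.
- move=> x y _ _ xy; rewrite !indicE.
  suff -> : (x \in cyl a) = (y \in cyl a) by rewrite subrr normr0.
  apply/idP/idP; rewrite !inE => h i ia; have := xy i (leq_trans ia as_).
    by move <-; exact: h.
  by move ->; exact: h.
- by rewrite leq_addl.
Qed.

(** Bounded distortion spreads the proportion from symbols to all measurable sets. Asking for it on
    symbols alone keeps the definition of a visit a countable list of conditions. *)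
Lemma cylinder_mass_ge (eta : R) : 0 <= eta ->
  (forall b, eta%:E * m s (cyl [:: b]) <= q (cyl [:: b]))%E ->
  forall E, measurable E ->
  ((eta * expR (- (2 * transfer_exponent kap r s 1)))%:E * m s E <= q E)%E.
Proof.
move=> eta0 h E mE; set t := 2 * _.
have mpre A : measurable A -> measurable (cyl a `&` iter s shift_seq @^-1` A).
  move=> mA; apply: measurableI; first exact: measurable_cyl.
  exact: measurable_shift_preimage.
have mcE b : measurable (cyl [:: b] `&` E).
  by apply: measurableI => //; exact: measurable_cyl.
have step b : ((eta * expR (- t))%:E * m s (cyl [:: b] `&` E) <= q (cyl [:: b] `&` E))%E.
  have mb := measurable_cyl [:: b].
  have hb := h b.
  have := @cylinder_mass_transfer [:: b] _ _ isT mb (mcE b) (@subset_refl _ _) (@subIsetl _ _ _).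
  have : (m s (cyl [:: b] `&` E) <= m s (cyl [:: b]))%E.
    by apply: le_measure; rewrite ?inE.
  move: hb; rewrite -/t.
  have [x x0 ->] := probability_EFin (m s) mb.
  have [y y0 ->] := probability_EFin (m s) (mcE b).
  have [x' x'0 ->] := probability_EFin (m 0%N) (mpre _ mb).
  have [y' y'0 ->] := probability_EFin (m 0%N) (mpre _ (mcE b)).
  rewrite -!EFinM !lee_fin => h1 h2 h3.
  have [xp|] := ltP 0 x; last first.
    move=> xle; have -> : y = 0 by apply/eqP; rewrite eq_le y0 (le_trans h2).
    by rewrite mulr0.
  rewrite -(ler_pM2r xp) -(ler_pM2l (expR_gt0 t)) expRN.
  have -> : expR t * (eta / expR t * y * x) = eta * x * y.
    by field; rewrite gt_eqF ?expR_gt0.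
  by apply: le_trans h3; exact: ler_wpM2r.
rewrite (measure_slices (m s) mE) -nneseriesZl//.
have -> : q E = (\sum_(c <oo) q (cyl [:: c] `&` E))%E.
  have [EE tE] := slices E.
  rewrite [in LHS]EE preimage_bigcup setI_bigcupr measure_bigcup//=.
  - by apply: eq_eseriesl => i; rewrite in_setT.
  - by move=> c _; exact: mpre.
  - apply/trivIsetP => c c' _ _ cc'.
    move/trivIsetP : tE => /(_ c c' I I cc') h0.
    by rewrite setIACA -preimage_setI h0 preimage_set0 setI0.
apply: lee_nneseries => c _; last exact: step.
by rewrite mule_ge0// lee_fin mulr_ge0// expR_ge0.
Qed.

End cylinder_mass.

(** * Fibre measures *)

Section regular_points.
Context d (Omega : measurableType d) (R : realType).
Variables (theta : Omega -> Omega).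
Variables (W1 : Omega -> set nat) (alpha : Omega -> nat -> nat -> bool).
Variables (r : R) (kappa : Omega -> R) (phi : Omega -> natseq -> R).
Variable mu : Omega -> set natseq -> \bar R.
Local Notation X := (fibre theta W1 alpha).
Hypothesis mphi : forall w, measurable_fun (X w) (phi w).

(** The Dirac mass is a placeholder at the base points where [mu w] is not a measure, so that the
    family is total. *)
Definition fibre_measure (w : Omega) : probability natseq R :=
  if pselect (exists m : probability natseq R,
      forall B, measurable B -> mu w B = m B) is left h then projT1 (cid h)
  else \d_point.
Local Notation pr := fibre_measure.

Record regular (w : Omega) : Prop := Regular {
  regular_measure : forall B, measurable B -> mu w B = pr w B ;
  regular_support : msupport (pr w) = X w ;
  regular_ruelle1 : forall x, X (theta w) x ->
    ruelle theta W1 alpha phi w (fun=> 1) x = 1%E ;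
  regular_dual : forall f : natseq -> R,
    measurable_fun (X w) f -> (forall x, 0 <= f x) ->
    (\int[mu (theta w)]_(x in X (theta w)) ruelle theta W1 alpha phi w f x
     = \int[mu w]_(x in X w) (f x)%:E)%E ;
  regular_variation : forall n, (2 <= n)%N ->
    (Defs.variation theta W1 alpha n w phi <= (kappa w * r ^+ n)%:E)%E }.

Lemma fibre_measureE w :
  (exists m : probability natseq R, forall B, measurable B -> mu w B = m B) ->
  forall B, measurable B -> mu w B = pr w B.
Proof.
move=> h B mB; rewrite /fibre_measure; case: pselect => [h'|/(_ h)//].
by case: (cid h') => m /= ->.
Qed.

Lemma fibre_measure1 w : regular w -> pr w (X w) = 1%E.
Proof.
move=> rw; rewrite -(regular_support rw); apply: support_full.
by rewrite (regular_support rw); exact: measurable_fibre.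
Qed.

Lemma ruelle_ge0 w f x : (forall x, 0 <= f x) ->
  ruelle theta W1 alpha phi w f x =
  (\esum_(y in [set y | X w y /\ shift_seq y = x]) (expR (phi w y) * f y)%:E)%E.
Proof.
move=> f0; rewrite /ruelle.
have F0 y : 0 <= expR (phi w y) * f y by rewrite mulr_ge0// expR_ge0.
rewrite [X in (_ - X)%E]esum1 ?sube0; last first.
  by move=> y _; apply/max_idPr; rewrite leeNl oppe0 lee_fin.
by apply: eq_esum => y _; apply/max_idPl; rewrite lee_fin.
Qed.

Lemma integral_fibre_indic w E : measurable E -> regular w ->
  (\int[pr w]_(x in X w) (\1_E x)%:E)%E = pr w E.
Proof.
move=> mE rw; have mX := measurable_fibre theta W1 alpha w.
rewrite integral_indic//; exact/esym/(full_setI mX (fibre_measure1 rw) mE).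
Qed.

(** The Ruelle operator sends the indicator of the preimage of [E] to [\1_E] times its value at 1,
    that is to [\1_E]. *)
Lemma fibre_measure_invariant w E : regular w -> regular (theta w) ->
  measurable E -> pr (theta w) E = pr w (shift_seq @^-1` E).
Proof.
move=> rw rw' mE; have mT : measurable (shift_seq @^-1` E).
  exact: (measurable_shift_preimage 1 mE).
rewrite -!integral_fibre_indic//.
rewrite -(eq_integral_set_function _ _ (regular_measure rw)).
rewrite -(eq_integral_set_function _ _ (regular_measure rw')).
rewrite -(regular_dual rw)//.
apply: eq_integrand_set_function => x; rewrite inE => Xx; rewrite ruelle_ge0//.
have [Ex|nEx] := pselect (E x).
  rewrite indicE mem_set// -(regular_ruelle1 rw Xx) ruelle_ge0//.
  apply: eq_esum => y [_ yx]; rewrite indicE mem_set//.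
  by rewrite /preimage/= yx.
rewrite indicE memNset//= esum1// => y [_ yx].
by rewrite indicE memNset ?mulr0//= yx.
Qed.

(** The test function [expR (- phi w y) * \1_A y] cancels the weight of the branch [c] and kills the
    other branches, so its Ruelle image is [\1_E]: the Jacobian of the shift on [A] is
    [expR (- phi w y)]. There it differs from its value at [y0] by a factor of at most [expR h]. *)
Lemma fibre_measure_branch w c E (y0 : natseq) h : regular w -> regular (theta w) ->
  measurable E ->
  (forall x, E x -> X (theta w) x -> X w (prepend c x)) ->
  (forall y, X w y -> y 0%N = c -> E (shift_seq y) ->
    `|phi w y - phi w y0| <= h) ->
  ((expR (- phi w y0 - h))%:E * pr w (cyl [:: c] `&` shift_seq @^-1` E)
     <= pr (theta w) E)%E /\
  (pr (theta w) E <=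
    (expR (- phi w y0 + h))%:E * pr w (cyl [:: c] `&` shift_seq @^-1` E))%E.
Proof.
move=> rw rw' mE EX hh; set A := _ `&` _.
have mA : measurable A.
  apply: measurableI; first exact: measurable_cyl.
  exact: (measurable_shift_preimage 1 mE).
have mX := measurable_fibre theta W1 alpha w.
have mX' := measurable_fibre theta W1 alpha (theta w).
pose f y := expR (- phi w y) * \1_A y.
have f0 y : 0 <= f y by rewrite mulr_ge0// expR_ge0.
have mf : measurable_fun (X w) f.
  apply: measurable_funM.
    apply: measurableT_comp => //; apply: measurableT_comp => //; exact: mphi.
  exact: measurable_indic.
have key : pr (theta w) E = (\int[pr w]_(x in X w) (f x)%:E)%E.
  rewrite -integral_fibre_indic//.
  rewrite -(eq_integral_set_function _ _ (regular_measure rw)).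
  rewrite -(eq_integral_set_function _ _ (regular_measure rw')).
  rewrite -(regular_dual rw)//; apply: eq_integrand_set_function => x; rewrite inE => Xx.
  rewrite ruelle_ge0//.
  have FE y : expR (phi w y) * f y = \1_A y.
    by rewrite /f mulrA -expRD subrr expR0 mul1r.
  under eq_esum do rewrite FE.
  have [Ex|nEx] := pselect (E x); last first.
    rewrite indicE memNset//= esum1// => y [_ yx].
    by rewrite indicE memNset//= /A => -[_]; rewrite /preimage/= yx.
  rewrite indicE mem_set//.
  (* The only preimage of [x] that contributes is [prepend c x]. *)
  rewrite -(@esum_set1 _ _ (prepend c x) (fun=> 1%E))//.
  rewrite esum_mkcond [RHS]esum_mkcond; apply: eq_esum => y _.
  case: ifPn; rewrite ?(inE, notin_setE)/= => yp; case: ifPn;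
    rewrite ?(inE, notin_setE)/= => yD.
  - rewrite indicE mem_set// yp; split; last exact: Ex.
    by move=> [|].
  - by exfalso; apply: yD; rewrite yp; split => //; exact: EX.
  - move: yD => [Xy yx]; rewrite indicE memNset// => -[y0c _]; apply: yp.
    by rewrite -yx prepend_shift//; exact: (y0c 0%N isT).
  - by [].
rewrite key; have Ah y : X w y -> A y ->
    expR (- phi w y0 - h) <= expR (- phi w y) <= expR (- phi w y0 + h).
  move=> Xy [/(_ 0%N isT)/= yc Ey]; rewrite !ler_expR.
  by have := hh y Xy yc Ey; rewrite ler_norml => /andP[]; lra.
have mI : measurable_fun (X w) (\1_A : natseq -> R) by exact: measurable_indic.
have cA (k : R) : 0 <= k -> (k%:E * pr w A = \int[pr w]_(x in X w) (k * \1_A x)%:E)%E.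
  move=> k0; rewrite -integral_fibre_indic// -ge0_integralZl_EFin//.
  apply/measurable_EFinP; exact: mI.
have mkA (k : R) : measurable_fun (X w) (EFin \o (fun x => k * \1_A x)).
  apply/measurable_EFinP; exact: (measurable_funM (measurable_cst k) mI).
have mf' : measurable_fun (X w) (EFin \o f) by exact/measurable_EFinP.
have Ale x : X w x -> expR (- phi w y0 - h) * \1_A x <= f x <=
    expR (- phi w y0 + h) * \1_A x.
  move=> Xx; rewrite /f !indicE; have [xA|_] := boolP (x \in A).
    by rewrite !mulr1; apply: Ah => //; rewrite inE in xA.
  by rewrite !mulr0 lexx.
have k0 (k : R) x : X w x -> (0 <= (expR k * \1_A x)%:E)%E.
  by move=> _; rewrite lee_fin mulr_ge0// expR_ge0.
rewrite !cA ?expR_ge0//; split; apply: ge0_le_integral.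
- exact: mX.
- by move=> x; exact: k0.
- exact: mkA.
- exact: mf'.
- by move=> x /Ale/andP[]; rewrite lee_fin.
- exact: mX.
- by move=> x _; rewrite lee_fin.
- exact: mf'.
- exact: mkA.
- by move=> x /Ale/andP[_]; rewrite lee_fin.
Qed.

Lemma variation_le n w (v : R) x y :
  (Defs.variation theta W1 alpha n w phi <= v%:E)%E -> X w x -> X w y ->
  (forall i, (i < n)%N -> x i = y i) -> `|phi w x - phi w y| <= v.
Proof.
move=> h Xx Xy xy; rewrite -lee_fin; apply: le_trans h.
by apply: ereal_sup_ubound; exists x, y.
Qed.

Lemma fibre_measure_distortion w c b E E' : regular w -> regular (theta w) ->
  (0 < size b)%N -> measurable E -> measurable E' ->
  E `<=` cyl b -> E' `<=` cyl b ->
  (pr w (cyl [:: c] `&` shift_seq @^-1` E) * pr (theta w) E' <=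
   (expR (2 * (kappa w * r ^+ (size b).+1)))%:E *
     (pr w (cyl [:: c] `&` shift_seq @^-1` E') * pr (theta w) E))%E.
Proof.
move=> rw rw' b0 mE mE' Eb E'b.
have mA F : measurable F -> measurable (cyl [:: c] `&` shift_seq @^-1` F).
  move=> mF; apply: measurableI; first exact: measurable_cyl.
  exact: (measurable_shift_preimage 1 mF).
(* Any point of the fibre in [cyl (c :: b)] serves as reference for both sets; without one the
   left-hand side is 0. *)
have [[y0 [Xy0 y0cb]]|no] := pselect (X w `&` cyl (c :: b) !=set0); last first.
  have mX := measurable_fibre theta W1 alpha w.
  have -> : pr w (cyl [:: c] `&` shift_seq @^-1` E) = 0%E.
    rewrite (full_setI mX (fibre_measure1 rw) (mA _ mE)).
    rewrite (_ : _ `&` X w = set0) ?measure0//.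
    apply/seteqP; split => // y [[yc Ey] Xy]; apply: no; exists y; split => //.
    by rewrite cyl_cons; split => //; exact: Eb.
  rewrite mul0e; apply: mule_ge0; first by rewrite lee_fin expR_ge0.
  exact: mule_ge0.
have y0c : y0 0%N = c by exact: (y0cb 0%N isT).
have y01 : y0 1%N = nth 0%N b 0 by exact: (y0cb 1%N b0).
set h := kappa w * _.
have EX F : F `<=` cyl b -> forall x, F x -> X (theta w) x -> X w (prepend c x).
  move=> Fb x Fx Xx; have [Wc ac] := Xy0 0%N; apply: fibre_prepend => //.
    by rewrite -y0c.
  by rewrite -y0c (Fb _ Fx 0%N b0) -y01.
have hh F : F `<=` cyl b -> forall y, X w y -> y 0%N = c -> F (shift_seq y) ->
    `|phi w y - phi w y0| <= h.
  (* As [b] is nonempty, [c :: b] has length at least 2, the index from which the Hoelder bound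
     holds. *)
  move=> Fb y Xy yc Fy; apply: (variation_le (regular_variation rw (n := (size b).+1) _)) => //.
  have yb : cyl (c :: b) y.
    by rewrite cyl_cons; split; [case|exact: Fb].
  by move=> i ib; rewrite (yb i ib) (y0cb i ib).
have [l1 u1] := fibre_measure_branch rw rw' mE (EX _ Eb) (hh _ Eb).
have [l2 u2] := fibre_measure_branch rw rw' mE' (EX _ E'b) (hh _ E'b).
move: l1 u1 l2 u2.
have [x x0 ->] := probability_EFin (pr w) (mA _ mE).
have [x' x'0 ->] := probability_EFin (pr w) (mA _ mE').
have [z z0 ->] := probability_EFin (pr (theta w)) mE.
have [z' z'0 ->] := probability_EFin (pr (theta w)) mE'.
rewrite -!EFinM !lee_fin => l1 _ _ u2.
set p := phi w y0 in l1 u2.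
have H : expR (- p - h) * x * z' <= z * (expR (- p + h) * x').
  apply: ler_pM => //; by rewrite mulr_ge0// expR_ge0.
rewrite -(ler_pM2l (expR_gt0 (- p - h))) [X in X <= _]mulrA; apply: (le_trans H).
rewrite (_ : - p + h = (- p - h) + 2 * h); last by lra.
by rewrite expRD; set e1 := expR _; set e2 := expR _; lra.
Qed.

End regular_points.

Lemma expr_small (R : realType) (r e : R) : 0 < r -> r < 1 -> 0 < e ->
  exists n, r ^+ n <= e.
Proof.
move=> r0 r1 e0; have : `|r| < 1 by rewrite gtr0_norm.
move=> /cvg_expr/cvgr0_norm_lt/(_ _ e0)[n _ /(_ n (leqnn n))/=].
by rewrite ger0_norm ?exprn_ge0 ?ltW// => h; exists n; exact: ltW.
Qed.

(** * Fibrewise Lipschitz functions *)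

Section lipschitz.
Context d (Omega : measurableType d) (R : realType) (theta : Omega -> Omega).
Variables (W1 : Omega -> set nat) (alpha : Omega -> nat -> nat -> bool).
Variables (r : R) (f : Omega -> natseq -> R) (w : Omega).
Local Notation X := (fibre theta W1 alpha w).
Hypotheses (r0 : 0 < r) (r1 : r < 1).

Lemma lipschitz_const_ge0 : (0 <= lipschitz_const theta W1 alpha r w f)%E.
Proof. by apply: ereal_sup_ubound; left. Qed.

Variable D : R.
Hypothesis fD : lipschitz_const theta W1 alpha r w f = D%:E.

Lemma lipschitz_agree n x y : X x -> X y ->
  (forall i, (i < n)%N -> x i = y i) -> `|f w x - f w y| <= D * r ^+ n.
Proof.
have D0 : 0 <= D by rewrite -lee_fin -fD lipschitz_const_ge0.
move=> Xx Xy xy; have [->|xney] := pselect (x = y).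
  by rewrite subrr normr0 mulr_ge0// exprn_ge0// ltW.
have : ((`|f w x - f w y| / dist_r r x y)%:E <= D%:E)%E.
  by rewrite -fD; apply: ereal_sup_ubound; right; exists x, y.
rewrite lee_fin /dist_r; case: pselect => [h|]; last first.
  move=> h; exfalso; apply: xney; apply/funext => i; apply: contrapT => xyi.
  by apply: h; exists i; apply/eqP.
case: ex_minnP => k xyk _; rewrite ler_pdivrMr ?exprn_gt0// => /le_trans; apply.
apply: ler_wpM2l => //; rewrite ler_wiXn2l ?ltW//.
by rewrite leqNgt; apply/negP => /xy/eqP; apply/negP.
Qed.

(** Strict superlevel sets are relatively open in the fibre. *)
Lemma lipschitz_measurable : measurable_fun X (f w).
Proof.
have mX := measurable_fibre theta W1 alpha w => _.
apply: (measurability _ (RGenOInfty.measurableE R)) => //.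
move=> _ [_ [a ->] <-].
have [|V mV] := @measurable_cyl_union (f w @^-1` `]a, +oo[) X.
  move=> x Xx; rewrite /preimage/= in_itv/= andbT => afx.
  have D0 : 0 <= D by rewrite -lee_fin -fD lipschitz_const_ge0.
  have D1 : 0 < D + 1 by rewrite ltr_wpDl.
  (* [D] may vanish, hence [D + 1]; the half keeps the final inequality strict. *)
  have e0 : 0 < (f w x - a) / (D + 1) / 2 by rewrite !divr_gt0// subr_gt0.
  have [n hn] := expr_small r0 r1 e0; exists n => y [/cyl_mkseqE yx Xy].
  rewrite /preimage/= in_itv/= andbT.
  have := @lipschitz_agree n y x Xy Xx yx.
  have : D * r ^+ n <= (D + 1) * ((f w x - a) / (D + 1) / 2).
    by apply: ler_pM => //; rewrite ?lerDl// exprn_ge0// ltW.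
  have -> : (D + 1) * ((f w x - a) / (D + 1) / 2) = (f w x - a) / 2.
    by field; rewrite gt_eqF.
  rewrite ler_norml; lra.
by move=> ->; exact: measurableI.
Qed.

Variable m : probability natseq R.
Hypothesis mX1 : m X = 1%E.
Hypothesis f0 : (\int[m]_(x in X) (f w x)%:E = 0)%E.

Lemma lipschitz_bounded x y : X x -> X y -> `|f w x - f w y| <= D.
Proof. by move=> Xx Xy; have := @lipschitz_agree 0 x y Xx Xy; rewrite mulr1; apply. Qed.

Lemma lipschitz_integrable : m.-integrable X (EFin \o f w).
Proof.
have mX := measurable_fibre theta W1 alpha w.
have [[x0 Xx0]|noX] := pselect (X !=set0); last first.
  suff -> : X = set0 by exact: integrable_set0.
  by apply/seteqP; split => // x Xx; apply: noX; exists x.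
apply: measurable_bounded_integrable => //.
  exact: le_lt_trans (probability_le1 m mX) (ltry _).
  exact: lipschitz_measurable.
exists (`|f w x0| + D); split; first exact: num_real.
move=> M ltM x Xx /=; apply: (le_trans _ (ltW ltM)).
have := lipschitz_bounded Xx Xx0; have := ler_normD (f w x - f w x0) (f w x0).
by rewrite subrK; lra.
Qed.

(** Integrate [f w x - D <= f w y <= f w x + D] over [y]: the mean of [f w] is 0. *)
Lemma lipschitz_centered x : X x -> `|f w x| <= D.
Proof.
move=> Xx; have mX := measurable_fibre theta W1 alpha w.
have icst (c : R) : m.-integrable X (EFin \o cst c).
  by apply: finite_measure_integrable_cst.
have icE (c : R) : (\int[m]_(x in X) (cst c x)%:E = c%:E)%E.
  by apply: (eq_trans (integral_EFin_cst m c mX)); rewrite [Z in (_ * Z)%E]mX1 mule1.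
have h1 : ((f w x - D)%:E <= 0)%E.
  rewrite -f0 -icE; apply: le_integral => //; [exact: icst|exact: lipschitz_integrable|].
  move=> y; rewrite inE => Xy; rewrite lee_fin /cst.
  by have := lipschitz_bounded Xx Xy; rewrite ler_norml; lra.
have h2 : (0 <= (f w x + D)%:E)%E.
  rewrite -f0 -icE; apply: le_integral => //; [exact: lipschitz_integrable|exact: icst|].
  move=> y; rewrite inE => Xy; rewrite lee_fin /cst.
  by have := lipschitz_bounded Xx Xy; rewrite ler_norml; lra.
by move: h1 h2; rewrite !lee_fin ler_norml; lra.
Qed.

End lipschitz.

(** * Visits to a contracting set *)

Lemma iter_cancel (T : Type) (f g : T -> T) k n x : cancel f g -> (k <= n)%N ->
  iter k g (iter n f x) = iter (n - k) f x.
Proof.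
move=> fg; elim: k n => [|k ih] [|n] // kn.
by rewrite iterSr iterS fg ih// subSS.
Qed.

(** The exponent in [holder_bound]. *)
Definition past_variation (T : Type) (R : realType) (thetaV : T -> T) (r : R)
    (kappa : T -> R) (w : T) : \bar R :=
  (\sum_(1 <= k <oo) (kappa (iter k thetaV w) * r ^+ k)%:E)%E.

(** Read backwards, the sum involves [kappa] along the past of the endpoint, and [r ^+ j] factors
    out. A bound at the endpoint alone thus makes the distortion of long cylinders small, whatever
    [n] is. *)
Lemma transfer_exponent_le (T : Type) (R : realType) (theta thetaV : T -> T)
    (r : R) (kappa : T -> R) (w : T) n j (M : R) :
  cancel theta thetaV -> 0 < r -> (forall w, 0 <= kappa w) ->
  (past_variation thetaV r kappa (iter n theta w) <= M%:E)%E ->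
  transfer_exponent (fun i => kappa (iter i theta w)) r n j <= r ^+ j * M.
Proof.
move=> thK r0 k0 SM.
have -> : transfer_exponent (fun i => kappa (iter i theta w)) r n j = r ^+ j *
    \sum_(1 <= i < n.+1) kappa (iter i thetaV (iter n theta w)) * r ^+ i.
  rewrite /transfer_exponent (reindex_inj rev_ord_inj)/= big_add1/= big_mkord.
  rewrite mulr_sumr; apply: eq_bigr => -[i ltin] _ /=.
  rewrite -[thetaV _]/(iter i.+1 thetaV (iter n theta w)) iter_cancel//.
  rewrite [RHS]mulrCA -exprD; congr (_ * r ^+ _); lia.
apply: ler_wpM2l; first by rewrite exprn_ge0// ltW.
rewrite -lee_fin; apply: le_trans SM; rewrite -sumEFin.
apply: nneseries_lim_ge => i _ _.
by rewrite lee_fin mulr_ge0// exprn_ge0// ltW.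
Qed.

Section visits.
Context d (Omega : measurableType d) (R : realType).
Variables (theta thetaV : Omega -> Omega).
Variables (W1 : Omega -> set nat) (alpha : Omega -> nat -> nat -> bool).
Variables (r : R) (kappa : Omega -> R) (phi : Omega -> natseq -> R).
Variable mu : Omega -> set natseq -> \bar R.
Local Notation X := (fibre theta W1 alpha).
Local Notation pr := (fibre_measure mu).
Local Notation regular := (regular theta W1 alpha r kappa phi mu).
Local Notation S := (past_variation thetaV r kappa).
Hypothesis mphi : forall w, measurable_fun (X w) (phi w).
Hypotheses (thK : cancel theta thetaV).
Hypotheses (r0 : 0 < r) (r1 : r < 1) (kappa0 : forall w, 0 <= kappa w).

(* At a visit, the mass of every cylinder [b] at time [s] comes in proportion
   at least [eta] from the initial word [a]. *)
Definition visit (a : seq nat) (s : nat) (eta M M' : R) : set Omega :=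
  [set w | [/\ (S w <= M%:E)%E, (S (iter s theta w) <= M'%:E)%E &
    forall b : nat, (eta%:E * mu (iter s theta w) (cyl [:: b]) <=
      mu w (cyl a `&` iter s shift_seq @^-1` cyl [:: b]))%E]].

(** Non-overlapping windows of length [s] in [[n0, l]], each opening at a time in [G]. The delay
    [n0] makes the oscillation of the initial density small on the cylinders pulled back from a
    window. The recursion is on the last window, as a sandwich is improved forward in time. *)
Fixpoint visits (G : set Omega) (n0 s K l : nat) (w : Omega) : Prop :=
  if K is K'.+1 then
    exists t, [/\ (t + s <= l)%N, visits G n0 s K' t w & G (iter t theta w)]
  else (n0 <= l)%N.

Lemma visits_ge G n0 s K l w : visits G n0 s K l w -> (n0 <= l)%N.
Proof.
elim: K l => //= K ih l [t [tl /ih nt _]].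
by apply: leq_trans tl; exact: leq_trans nt (leq_addr _ _).
Qed.

Variable w : Omega.
Hypothesis reg : forall i, regular (iter i theta w).

Lemma orbit_invariant i E : measurable E ->
  pr (iter i.+1 theta w) E = pr (iter i theta w) (shift_seq @^-1` E).
Proof. by move=> mE; exact: (fibre_measure_invariant (reg i) (reg i.+1) mE). Qed.

Lemma orbit_distortion i c b E E' : (0 < size b)%N ->
  measurable E -> measurable E' -> E `<=` cyl b -> E' `<=` cyl b ->
  (pr (iter i theta w) (cyl [:: c] `&` shift_seq @^-1` E) * pr (iter i.+1 theta w) E' <=
   (expR (2 * (kappa (iter i theta w) * r ^+ (size b).+1)))%:E *
     (pr (iter i theta w) (cyl [:: c] `&` shift_seq @^-1` E') * pr (iter i.+1 theta w) E))%E.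
Proof.
by move=> b0 mE mE'; exact: (fibre_measure_distortion mphi c (reg i) (reg i.+1)).
Qed.

End visits.

(** * Decay along an orbit with many visits *)

Section decay.
Context d (Omega : measurableType d) (R : realType).
Variables (theta thetaV : Omega -> Omega).
Variables (W1 : Omega -> set nat) (alpha : Omega -> nat -> nat -> bool).
Variables (r : R) (kappa : Omega -> R) (phi : Omega -> natseq -> R).
Variable mu : Omega -> set natseq -> \bar R.
Local Notation X := (fibre theta W1 alpha).
Local Notation pr := (fibre_measure mu).
Local Notation regular := (regular theta W1 alpha r kappa phi mu).
Local Notation S := (past_variation thetaV r kappa).
Hypothesis mphi : forall w, measurable_fun (X w) (phi w).
Hypotheses (thK : cancel theta thetaV).
Hypotheses (r0 : 0 < r) (r1 : r < 1) (kappa0 : forall w, 0 <= kappa w).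
Variables (a : seq nat) (n0 s : nat) (eta eps M M' : R).
Hypotheses (a0 : (0 < size a)%N) (as_ : (size a <= s)%N).
Hypotheses (eta0 : 0 < eta) (eps01 : 0 <= eps <= 1).
Hypothesis aM : expR (2 * (r ^+ size a * M)) <= 1 + eps.
Hypothesis n0eps : r ^+ n0 <= eps.
Hypothesis M'0 : 0 <= M'.
Local Notation G := (visit theta thetaV r kappa mu a s eta M M').
Let eta' := eta * expR (- (2 * M')).

(** Cylinders of length 1 at time [s] have transfer exponent at most [r * M'], whence the factor
    [expR (- (2 * M'))] in [eta']. *)
Lemma visit_mass w E : (forall i, regular (iter i theta w)) -> G w -> measurable E ->
  (eta'%:E * pr (iter s theta w) E <= pr w (cyl a `&` iter s shift_seq @^-1` E))%E.
Proof.
move=> reg [Sw Ssw big] mE.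
have mcb b := measurable_cyl [:: b].
have h := @cylinder_mass_ge R (fun i => pr (iter i theta w))
  (fun i => kappa (iter i theta w)) r (orbit_invariant reg)
  (orbit_distortion mphi reg) a s as_ eta (ltW eta0).
have {}h := h _ E mE.
apply: le_trans (h _).
  apply: lee_wpmul2r => //; rewrite lee_fin; apply: ler_wpM2l; first exact: ltW.
  rewrite ler_expR lerN2 ler_pM2l//.
  apply: (le_trans (transfer_exponent_le 1 thK r0 kappa0 Ssw)).
  by rewrite expr1 ler_piMl// ltW.
move=> b; have := big b; rewrite (regular_measure (reg s))//.
rewrite (regular_measure (reg 0%N))//; apply: measurableI => //.
exact: measurable_cyl.
exact: measurable_shift_preimage.
Qed.

Variable w : Omega.
Hypothesis reg : forall i, regular (iter i theta w).

(** A visit maps a width bound [x] to [(1 - eta') * x + eta' * (8 * B * eps)]. The fixed point is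
    [8 * B * eps], so this term does not grow with [K]. *)
Lemma visits_sandwich (u : natseq -> R) (B : R) K l :
  measurable_fun setT u -> (forall x, 0 <= u x) -> (forall x, u x <= B) ->
  (forall x, ~ X w x -> u x = 0) ->
  (forall x y, X w x -> X w y ->
    (forall i, (i < n0)%N -> x i = y i) -> `|u x - u y| <= B * eps) ->
  visits theta G n0 s K l w ->
  exists lo hi, sandwich (fun i => pr (iter i theta w)) u l lo hi /\
    hi - lo <= (1 - eta') ^+ K * B + 8 * B * eps.
Proof.
move=> mu_ u0 uB uX osc; have B0 : 0 <= B by exact: le_trans (u0 point) (uB _).
have [eps0 eps1] := andP eps01.
have inv := orbit_invariant reg.
elim: K l => [|K ih] l /=.
  move=> _; exists 0, B; split.
    apply: (sandwich_leq inv (leq0n l)); exact: (sandwich0 inv mu_ u0 uB).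
  by rewrite expr0 mul1r subr0 lerDl !mulr_ge0.
move=> [t [tsl vis Gt]]; have [lo [hi [sand width]]] := ih _ vis.
have regt i : regular (iter i theta (iter t theta w)) by rewrite -iterD; exact: reg.
have mass E : measurable E -> (eta'%:E * pr (iter (t + s) theta w) E <=
    pr (iter t theta w) (cyl a `&` iter s shift_seq @^-1` E))%E.
  by move=> mE; rewrite addnC iterD; exact: visit_mass.
have eta'0 : 0 < eta' by rewrite mulr_gt0// expR_gt0.
have eta'1 : eta' <= 1.
  have := mass setT measurableT; rewrite preimage_setT setIT.
  have mA := measurable_cyl a.
  move=> /le_trans/(_ (probability_le1 (pr (iter t theta w)) mA)).
  have e1 := probability_setT (pr (iter (t + s) theta w)).
  by rewrite [Z in (_ * Z)%E]e1 mule1 lee_fin.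
have ea : expR (2 * transfer_exponent (fun i => kappa (iter i theta w)) r t (size a)) <= 1 + eps.
  apply: le_trans aM; rewrite ler_expR ler_pM2l//.
  have [St _ _] := Gt.
  exact: (transfer_exponent_le (size a) thK r0 kappa0 St).
have mX := measurable_fibre theta W1 alpha w.
have X1 := fibre_measure1 (reg 0%N).
have [lo' [hi' [sand' width']]] := sandwich_contraction inv
  (orbit_distortion mphi reg) mX X1 mu_ u0 uB uX (mulr_ge0 B0 eps0) osc
  (visits_ge vis) a0 eta'0 eps01 ea (lexx _) mass sand.
exists lo', hi'; split; first exact: (sandwich_leq inv tsl).
apply: (le_trans width').
have : (1 - eta') * (hi - lo) <= (1 - eta') * ((1 - eta') ^+ K * B + 8 * B * eps).
  by apply: ler_wpM2l => //; rewrite subr_ge0.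
by rewrite exprS; lra.
Qed.

Lemma decay_at_visits (f : Omega -> natseq -> R) (D : R) (g : natseq -> R) K l :
  lipschitz_const theta W1 alpha r w f = D%:E ->
  (\int[mu w]_(x in X w) (f w x)%:E = 0)%E ->
  measurable_fun (X (iter l theta w)) g ->
  (\int[mu (iter l theta w)]_(x in X (iter l theta w)) `|g x|%:E < +oo)%E ->
  visits theta G n0 s K l w ->
  (`| \int[mu w]_(x in X w) (f w x * g (iter l shift_seq x))%:E | <=
   ((1 - eta') ^+ K * (2 * D) + 16 * D * eps)%:E *
   \int[mu (iter l theta w)]_(x in X (iter l theta w)) `|g x|%:E)%E.
Proof.
rewrite !(eq_integral_set_function _ _ (regular_measure (reg 0%N))).
rewrite !(eq_integral_set_function _ _ (regular_measure (reg l))).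
move=> fD f0 mg gfin vis.
have mX := measurable_fibre theta W1 alpha w.
have X1 : pr w (X w) = 1%E by exact: (fibre_measure1 (reg 0%N)).
have D0 : 0 <= D by rewrite -lee_fin -fD lipschitz_const_ge0.
have fle x : X w x -> `|f w x| <= D by exact: (lipschitz_centered r0 r1 fD X1 f0).
have mf := lipschitz_measurable r0 r1 fD.
pose u := (fun x => f w x + D) \_ (X w).
have uE x : X w x -> u x = f w x + D by move=> Xx; rewrite /u patchE mem_set.
have uX x : ~ X w x -> u x = 0 by move=> Xx; rewrite /u patchE memNset.
have mu_ : measurable_fun setT u.
  by apply/(measurable_restrictT _ mX); exact: measurable_funD.
have u0 x : 0 <= u x.
  have [Xx|Xx] := pselect (X w x); last by rewrite uX.
  by rewrite uE//; have := fle x Xx; rewrite ler_norml; lra.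
have uB x : u x <= 2 * D.
  have [Xx|Xx] := pselect (X w x); last by rewrite uX// mulr_ge0.
  by rewrite uE//; have := fle x Xx; rewrite ler_norml; lra.
have osc x y : X w x -> X w y -> (forall i, (i < n0)%N -> x i = y i) ->
    `|u x - u y| <= 2 * D * eps.
  move=> Xx Xy xy; rewrite !uE// opprD addrACA subrr addr0.
  apply: (le_trans (lipschitz_agree r0 r1 fD Xx Xy xy)).
  have : D * r ^+ n0 <= D * eps by exact: ler_wpM2l.
  have [eps0 _] := andP eps01; have := mulr_ge0 D0 eps0; lra.
have [lo [hi [sand width]]] := visits_sandwich mu_ u0 uB uX osc vis.
have uint : (\int[pr w]_x (u x)%:E = D%:E)%E.
  rewrite -(integral_full mX X1 mu_ u0).
  have fi := lipschitz_integrable r0 r1 fD (pr w).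
  have -> : (\int[pr w]_(x in X w) (u x)%:E =
      \int[pr w]_(x in X w) ((f w x)%:E + (cst D x)%:E))%E.
    by apply: eq_integral => x; rewrite inE => Xx; rewrite uE// EFinD.
  rewrite integralD_EFin//; last exact: finite_measure_integrable_cst.
  rewrite [Z in (Z + _)%E]f0 add0e; apply: (eq_trans (integral_EFin_cst _ D mX)).
  by rewrite [Z in (_ * Z)%E]X1 mule1.
(* Tested on the whole space, the sandwich encloses the total mass [D] of [u]. *)
have [loD Dhi] : lo <= D /\ D <= hi.
  have [] := sand setT measurableT; rewrite /density_push preimage_setT uint.
  have e1 := probability_setT (pr (iter l theta w)).
  by rewrite (_ : pr (iter l theta w) setT = 1%E)// !mule1 !lee_fin.
have inv A : measurable A -> pr (iter l theta w) A = pr w (iter l shift_seq @^-1` A).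
  by move=> mA; exact: (invariant_iter (orbit_invariant reg) 0 l mA).
have XY x : X w x -> X (iter l theta w) (iter l shift_seq x).
  exact: fibre_iter_shift.
have fu x : X w x -> f w x = u x - D by move=> Xx; rewrite uE// addrK.
have mY := measurable_fibre theta W1 alpha (iter l theta w).
(* Averaging with [rho * (1 - eps) - 2 * del] may have made [lo] negative; since [u] is nonnegative,
   the positive part of [lo] is a lower bound too. *)
have lo0 : 0 <= Num.max lo 0 by rewrite le_max lexx orbT.
have loD' : Num.max lo 0 <= D by rewrite ge_max loD.
have sand' A : measurable A ->
  ((Num.max lo 0)%:E * pr (iter l theta w) A <=
     \int[pr w]_(x in iter l shift_seq @^-1` A) (u x)%:E)%E /\
  (\int[pr w]_(x in iter l shift_seq @^-1` A) (u x)%:E <=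
     hi%:E * pr (iter l theta w) A)%E.
  move=> mA; have [h1 h2] := sand A mA; split => //.
  case: (leP lo 0) => _ //; rewrite mul0e.
  by apply: integral_ge0 => x _; rewrite lee_fin.
apply: (le_trans (pairing_bound (measurable_iter_shift l) inv mu_ u0 lo0 loD' Dhi
  sand' mX X1 mY XY fu mg gfin)).
apply: lee_wpmul2r; first by apply: integral_ge0 => x _; rewrite lee_fin.
rewrite lee_fin; have : lo <= Num.max lo 0 by rewrite le_max lexx.
lra.
Qed.

End decay.

Lemma uniform_gt0 (R : realType) (T : eqType) (Q : T -> R -> Prop) (s : seq T) :
  (forall i e e', 0 < e' -> e' <= e -> Q i e -> Q i e') ->
  (forall i, exists2 e, 0 < e & Q i e) ->
  exists2 e, 0 < e & forall i, i \in s -> Q i e.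
Proof.
move=> mono h; elim: s => [|i s [e e0 ih]]; first by exists 1.
have [e' e'0 Qi] := h i; exists (Num.min e e'); first by rewrite lt_min e0.
have m0 : 0 < Num.min e e' by rewrite lt_min e0.
move=> k; rewrite inE => /predU1P[->|/ih].
  by apply: mono Qi => //; rewrite ge_min lexx orbT.
by apply: mono => //; rewrite ge_min lexx.
Qed.

Lemma uniform_nat (T : eqType) (Q : T -> nat -> Prop) (s : seq T) :
  (forall i n n', (n <= n')%N -> Q i n -> Q i n') ->
  (forall i, exists n, Q i n) -> exists n, forall i, i \in s -> Q i n.
Proof.
move=> mono h; elim: s => [|i s [n ih]]; first by exists 0%N.
have [n' Qi] := h i; exists (maxn n n') => k.
rewrite inE => /predU1P[->|/ih]; first exact: (mono _ _ _ (leq_maxr n n') Qi).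
exact/mono/leq_maxl.
Qed.

(** * Existence of contracting words *)

Section visit_existence.
Context d (Omega : measurableType d) (R : realType).
Variables (theta thetaV : Omega -> Omega).
Variables (W1 : Omega -> set nat) (alpha : Omega -> nat -> nat -> bool).
Variables (r : R) (kappa : Omega -> R) (phi : Omega -> natseq -> R).
Variable mu : Omega -> set natseq -> \bar R.
Local Notation X := (fibre theta W1 alpha).
Local Notation pr := (fibre_measure mu).
Local Notation regular := (regular theta W1 alpha r kappa phi mu).
Local Notation cylX := (cylinder theta W1 alpha).
Hypothesis mphi : forall w, measurable_fun (X w) (phi w).
Hypotheses (thK : cancel theta thetaV).
Variables (Omega_bp : set Omega) (I : set nat) (w : Omega).
Hypothesis finI : finite_set I.
Hypothesis big_preimages : forall w, Omega_bp w -> forall a, W1 w a ->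
  exists2 b, I b & words theta W1 alpha 2 (thetaV w) [:: b; a].
Hypothesis reg : forall i, regular (iter i theta w).
Hypothesis var1 : forall i, Omega_bp (iter i.+1 theta w) ->
  (Defs.variation theta W1 alpha 1 (iter i theta w) phi < +oo)%E.
Hypothesis mixing : forall i a b, W1 (iter i theta w) a ->
  Omega_word theta W1 alpha [:: a] (iter i theta w) ->
  exists N, forall n, (N <= n)%N ->
    Omega_word theta W1 alpha [:: b] (iter (n + i) theta w) ->
    cylX [:: a] (iter i theta w) `&`
      iter n shift_seq @^-1` cylX [:: b] (iter (n + i) theta w) !=set0.
Hypothesis recurrent : forall N, exists2 i, (N <= i)%N & Omega_bp (iter i theta w).

Definition splice (n : nat) (x y : natseq) : natseq :=
  fun k => if (k < n)%N then x k else y (k - n)%N.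

Lemma fibre_splice n x y : X w x -> X (iter n theta w) y -> y 0%N = x n ->
  X w (splice n x y).
Proof.
move=> Xx Xy yx k; rewrite /splice; have [kn|nk] := ltnP k n.
  have [Wk ak] := Xx k; split => //; have [kn'|nk'] := ltnP k.+1 n => //.
  have e : n = k.+1 by apply/eqP; rewrite eqn_leq nk' kn.
  by rewrite e subnn yx e.
have [Wk ak] := Xy (k - n)%N; rewrite -iterD subnK// in Wk ak.
by rewrite ltnNge (leq_trans nk (leqnSn k))/= subSn.
Qed.

Lemma fibre_open_gt0 (v : Omega) (A : set natseq) (z : natseq) n : regular v ->
  measurable A -> X v z -> (cyl (mkseq z n) `<=` A) -> (0 < pr v A)%E.
Proof.
move=> rv mA Xz zA; have := Xz; rewrite -(regular_support rv).
move=> /(_ _ (open_cyl (mkseq z n)) (@cyl_mkseq z n)) /lt_le_trans; apply.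
by apply: le_measure; rewrite ?inE//; exact: measurable_cyl.
Qed.

(** The mass is routed through the symbol [i] at time [s], which makes [eta] independent of [b]. [Q]
    is the mass of the route from [a] to [i], positive by full support; [C] is the distortion up to
    time [s]; [expR (phi v y0 - h)] bounds the mass of [i b] relative to that of [b], by the first
    variation of [phi]. *)
Lemma mass_through_symbol (a : seq nat) (s : nat) (i : nat) (z y0 : natseq) (h : R) :
  (size a <= s)%N -> X w z -> cyl a z -> z s = i ->
  X (iter s theta w) y0 -> y0 0%N = i ->
  (Defs.variation theta W1 alpha 1 (iter s theta w) phi <= h%:E)%E ->
  exists2 eta : R, 0 < eta & forall b, W1 (iter s theta w) i ->
    alpha (iter s theta w) i b ->
    (eta%:E * pr (iter s.+1 theta w) (cyl [:: b]) <=
     pr w (cyl a `&` iter s.+1 shift_seq @^-1` cyl [:: b]))%E.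
Proof.
move=> as_ Xz az zs Xy0 y0i vh.
pose v := iter s theta w; pose q E := pr w (cyl a `&` iter s shift_seq @^-1` E).
have mi := measurable_cyl [:: i].
have mpre E : measurable E -> measurable (cyl a `&` iter s shift_seq @^-1` E).
  move=> mE; apply: measurableI; first exact: measurable_cyl.
  exact: measurable_shift_preimage.
have qi : (0 < q (cyl [:: i]))%E.
  apply: (@fibre_open_gt0 w _ z s.+1 (reg 0%N)) => //; first exact: mpre.
  move=> x /cyl_mkseqE xz; split.
    by move=> k ka; rewrite xz ?az//; exact: leq_trans ka (leq_trans as_ (leqnSn s)).
  by move=> [_|//]; rewrite iter_shiftE addn0 xz.
have [Q Q0 QE] := probability_EFin (pr w) (mpre _ mi).
have Qp : 0 < Q by rewrite -lte_fin -QE.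
pose C := expR (2 * transfer_exponent (fun k => kappa (iter k theta w)) r s 1).
exists (expR (phi v y0 - h) * Q / C).
  by rewrite divr_gt0 ?mulr_gt0 ?expR_gt0.
move=> b Wi ab; have mb := measurable_cyl [:: b].
have msl : measurable (cyl [:: i] `&` shift_seq @^-1` cyl [:: b]).
  by apply: measurableI => //; exact: (measurable_shift_preimage 1 mb).
have [||_ up] := @fibre_measure_branch _ _ _ theta W1 alpha r kappa phi mu mphi
  v i (cyl [:: b]) y0 h (reg s) (reg s.+1) mb.
- move=> x xb Xx; apply: fibre_prepend => //.
  by rewrite (xb 0%N isT).
- move=> y Xy yi _; apply: (variation_le vh) => // k.
  by rewrite ltnS leqn0 => /eqP->; rewrite yi y0i.
move: up; have := @cylinder_mass_transfer R (fun k => pr (iter k theta w))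
  (fun k => kappa (iter k theta w)) r (orbit_invariant reg)
  (orbit_distortion mphi reg) a s as_ [:: i] _ _ isT mi msl
  (@subset_refl _ _) (@subIsetl _ _ _).
rewrite -/C -/v.
have -> : cyl a `&` iter s.+1 shift_seq @^-1` cyl [:: b] =
    cyl a `&` iter s shift_seq @^-1` (shift_seq @^-1` cyl [:: b]) by [].
have sub : (pr w (cyl a `&` iter s shift_seq @^-1`
      (cyl [:: i] `&` shift_seq @^-1` cyl [:: b])) <=
    pr w (cyl a `&` iter s shift_seq @^-1` (shift_seq @^-1` cyl [:: b])))%E.
  apply: le_measure; rewrite ?inE.
  - exact: mpre.
  - by apply: mpre; exact: (measurable_shift_preimage 1 mb).
  - by move=> x [ax [_ xb]]; split.
have le1 : (pr v (cyl [:: i]) <= 1)%E := probability_le1 (pr v) mi.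
move: sub le1; rewrite [Z in (Z * _ <= _)%E]QE.
have [x x0 ->] := probability_EFin (pr v) mi.
have [y y0' ->] := probability_EFin (pr v) msl.
have [z' z'0 ->] := probability_EFin (pr w) (mpre _ msl).
have [u u0 ->] := probability_EFin (pr w) (mpre _ (measurable_shift_preimage 1 mb)).
have [t t0 ->] := probability_EFin (pr (iter s.+1 theta w)) mb.
rewrite -!EFinM !lee_fin => z'u x1 h1 h2.
have C0 : 0 < C by exact: expR_gt0.
rewrite -(ler_pM2l C0).
have -> : C * (expR (phi v y0 - h) * Q / C * t) = Q * (expR (phi v y0 - h) * t).
  by field; rewrite gt_eqF.
have h3 : expR (phi v y0 - h) * t <= y.
  rewrite -(ler_pM2l (expR_gt0 (- phi v y0 + h))) mulrA -expRD.
  by rewrite (_ : - phi v y0 + h + (phi v y0 - h) = 0) ?expR0 ?mul1r//; lra.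
apply: (le_trans (ler_wpM2l Q0 h3)); apply: (le_trans h1).
apply: ler_wpM2l; first exact: ltW.
by apply: le_trans z'u; rewrite ler_piMr.
Qed.

(** The word can be the prefix of any point of the fibre: mixing starts from its last symbol only,
    and one waiting time [N] serves the whole finite set [I]. *)
Lemma visit_word_exists j : (0 < j)%N -> exists (a : seq nat) (s : nat) (eta : R),
  [/\ size a = j, (j <= s)%N, 0 < eta &
   forall b, (eta%:E * pr (iter s theta w) (cyl [:: b]) <=
     pr w (cyl a `&` iter s shift_seq @^-1` cyl [:: b]))%E].
Proof.
case: j => // j _.
have [x Xx] : X w !=set0.
  apply/set0P/eqP => X0; have := fibre_measure1 (reg 0%N).
  by rewrite /= X0 measure0 => /eqP; rewrite eq_sym onee_eq0.
have Xj := fibre_iter_shift j Xx.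
have [Wj _] := Xx j.
have ej : Omega_word theta W1 alpha [:: x j] (iter j theta w).
  exists (iter j shift_seq x); split => // -[|//] _.
  by rewrite iter_shiftE addn0.
have [sI IE] := (finite_seqP I).1 finI.
have [N hN] := @uniform_nat nat (fun b N => forall n, (N <= n)%N ->
    Omega_word theta W1 alpha [:: b] (iter (n + j) theta w) ->
    cylX [:: x j] (iter j theta w) `&`
      iter n shift_seq @^-1` cylX [:: b] (iter (n + j) theta w) !=set0) sI
  (fun b n n' nn' h k n'k => h k (leq_trans nn' n'k)) (fun b => mixing b Wj ej).
(* The return time to [Omega_bp] is written [s.+1]: the symbols of [I] sit one step earlier, at time
   [s]. *)
have [[//|s] hs bps] := recurrent (j + N).+2.
have jNs : (j + N < s)%N by [].
have js : (j.+1 <= s)%N by apply: leq_ltn_trans jNs; exact: leq_addr.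
have jls : (j <= s)%N by exact: ltnW.
have [h vh] : exists h : R, (Defs.variation theta W1 alpha 1 (iter s theta w) phi <= h%:E)%E.
  have := var1 bps; case: (Defs.variation _ _ _ _ _ _) => [h|//|] _; first by exists h.
  (* The remaining case is [-oo], the supremum of the empty set. *)
  by exists 0; rewrite leNye.
pose a := mkseq x j.+1.
have sa : size a = j.+1 by rewrite size_mkseq.
(* The premises make this vacuous for symbols outside [I] or not realised at time [s], so that every
   [i] has a positive [eta]. *)
pose Q i (eta : R) := I i -> forall b, W1 (iter s theta w) i ->
    alpha (iter s theta w) i b ->
    Omega_word theta W1 alpha [:: i] (iter s theta w) ->
    (eta%:E * pr (iter s.+1 theta w) (cyl [:: b]) <=
     pr w (cyl a `&` iter s.+1 shift_seq @^-1` cyl [:: b]))%E.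
have mono i e e' : 0 < e' -> e' <= e -> Q i e -> Q i e'.
  move=> _ e'e H Ii b Wi ab Oi; apply: le_trans (H Ii b Wi ab Oi).
  by apply: lee_wpmul2r; rewrite ?lee_fin.
have key i : exists2 eta : R, 0 < eta & Q i eta.
  have [Ii|nIi] := pselect (I i); last by exists 1.
  have [Oi|nOi] := pselect (Omega_word theta W1 alpha [:: i] (iter s theta w)); last first.
    by exists 1.
  have isI : i \in sI by move: Ii; rewrite IE.
  have := hN i isI (s - j)%N; rewrite subnK// leq_subRL ?(ltnW js)// (ltnW jNs).
  move=> /(_ isT Oi) [y [[Xy yx] [_ yi]]].
  have [y0 [Xy0 y0i]] := Oi.
  have [||||eta eta0 heta] := @mass_through_symbol a s i (splice j x y) y0 h
    _ _ _ _ Xy0 (y0i 0%N isT) vh.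
  - by rewrite sa.
  - by apply: fibre_splice => //; exact: (yx 0%N isT).
  - move=> k; rewrite sa ltnS => kj; rewrite nth_mkseq// /splice.
    case: ltnP => // jk; have -> : k = j by apply/eqP; rewrite eqn_leq kj jk.
    by rewrite subnn; exact: (yx 0%N isT).
  - rewrite /splice ltnNge jls/=; have := yi 0%N isT.
    by rewrite iter_shiftE addn0.
  by exists eta => // _ b Wi ab _; exact: heta.
have [eta eta0 heta] := uniform_gt0 sI mono key.
exists a, s.+1, eta; split => //.
move=> b; have mb := measurable_cyl [:: b].
(* A symbol that starts no point of the fibre at time [s.+1] has mass 0 there. *)
have [[x' [Xx' x'b]]|no] := pselect (X (iter s.+1 theta w) `&` cyl [:: b] !=set0); last first.
  have mX := measurable_fibre theta W1 alpha (iter s.+1 theta w).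
  rewrite (_ : pr (iter s.+1 theta w) (cyl [:: b]) = 0%E) ?mule0//.
  rewrite (full_setI mX (fibre_measure1 (reg s.+1)) mb).
  rewrite (_ : _ `&` _ = set0) ?measure0//.
  by apply/seteqP; split => // y [yb Xy]; apply: no; exists y.
have [Wb _] := Xx' 0%N; rewrite (x'b 0%N isT) in Wb.
have [i Ii [_ Wi ai]] := big_preimages bps Wb.
have vE : thetaV (iter s.+1 theta w) = iter s theta w by rewrite iterS thK.
rewrite vE in Wi ai; have {}Wi := Wi 0%N isT; have {}ai := ai 0%N isT.
apply: (heta i) => //.
  by move: Ii; rewrite {1}IE.
exists (prepend i x'); split; last by case.
by apply: fibre_prepend => //; rewrite (x'b 0%N isT).
Qed.

End visit_existence.

(** * Recurrence *)

Section recurrence.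
Context d (Omega : measurableType d) (R : realType) (P : probability Omega R).
Variable T : Omega -> Omega.
Hypothesis mT : measurable_fun setT T.
Hypothesis preserving : forall A, measurable A -> P (T @^-1` A) = P A.

Lemma preserving_iter n A : measurable A -> P (iter n T @^-1` A) = P A.
Proof.
elim: n A => // n ih A mA.
rewrite (_ : iter n.+1 T @^-1` A = iter n T @^-1` (T @^-1` A))//.
rewrite ih ?preserving//.
exact: (measurable_iter_preimage mT 1 mA).
Qed.

Lemma ae_orbit (Q : Omega -> Prop) : {ae P, forall w, Q w} ->
  {ae P, forall w, forall i, Q (iter i T w)}.
Proof.
move=> [A [mA A0 QA]]; apply: ae_foralln => i.
exists (iter i T @^-1` A); split.
- exact: measurable_iter_preimage.
- exact: (eq_trans (preserving_iter i mA) A0).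
- by move=> w /= h; exact: QA.
Qed.

Hypothesis ergodic : forall A, measurable A -> T @^-1` A = A ->
  P A = 0%E \/ P A = 1%E.

(** The upper limit of the preimages of [G] is exactly invariant, and its probability, a limit of
    those of unions each containing a preimage of [G], is at least [P G]. *)
Lemma ae_recurrent (G : set Omega) : measurable G -> (0 < P G)%E ->
  {ae P, forall w, forall N, exists2 i, (N <= i)%N & G (iter i T w)}.
Proof.
move=> mG G0; pose F i := iter i T @^-1` G.
have mF i : measurable (F i) by exact: measurable_iter_preimage.
have mL : measurable (lim_sup_set F).
  by apply: bigcapT_measurable => n; exact: bigcup_measurable.
have invL : T @^-1` (lim_sup_set F) = lim_sup_set F.
  apply/seteqP; split => w h n _.
    have [i /= ni Fi] := h n I; exists i.+1; first exact: leqW.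
    by change (G (iter i.+1 T w)); rewrite iterSr; exact: Fi.
  have [[//|i] /= ni Fi] := h n.+1 I; exists i => //.
  by change (G (iter i T (T w))); rewrite -iterSr.
have PL : (0 < P (lim_sup_set F))%E.
  apply: (lt_le_trans G0).
  have h := @lim_sup_set_cvg _ _ _ P F mF.
  have {}h := h (le_lt_trans (probability_le1 P (bigcup_measurable (fun k _ => mF k))) (ltry _)).
  rewrite -(cvg_lim _ h)//; apply: lime_ge.
    by apply/cvg_ex; eexists; exact: h.
  apply: nearW => n; rewrite -(preserving_iter n mG).
  apply: le_measure; rewrite ?inE.
  - exact: mF.
  - exact: bigcup_measurable.
  - by move=> w Fw; exists n => /=.
have P1 : P (lim_sup_set F) = 1%E.
  by case: (ergodic mL invL) => // e0; rewrite e0 ltxx in PL.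
exists (~` lim_sup_set F); split.
- exact: measurableC.
- by apply: (eq_trans (probability_setC P mL)); rewrite [Z in (_ - Z)%E]P1 subee.
- move=> w /= h Lw; apply: h => N.
  by have [i /= Ni Fi] := Lw N I; exists i.
Qed.

End recurrence.

(** * Almost sure finiteness of the past distortion *)

Section log_summability.
Context d (Omega : measurableType d) (R : realType) (P : probability Omega R).
Variables (theta : Omega -> Omega) (r : R) (kappa : Omega -> R).
Hypothesis mtheta : measurable_fun setT theta.
Hypothesis preserving : forall A, measurable A -> P (theta @^-1` A) = P A.
Hypotheses (r0 : 0 < r) (r1 : r < 1).
Hypotheses (mkappa : measurable_fun setT kappa) (kappa0 : forall w, 0 <= kappa w).
Hypothesis log_integrable : (\int[P]_w maxe (lne (kappa w)%:E) 0 < +oo)%E.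

(** Half of log(1/r): of the two factors [expR (- c)] of [r], one absorbs the growth of [kappa] and
    the other is summed. *)
Let c := - ln r / 2.

Let c0 : 0 < c.
Proof. by rewrite divr_gt0// oppr_gt0 ln_lt0// r0. Qed.

Let rE : r = expR (- c) * expR (- c).
Proof. by rewrite -expRD -{1}(lnK r0); congr expR; rewrite /c; lra. Qed.

Let Y w := Num.max (ln (kappa w)) 0.

(** At [kappa w = 0], [lne] is [-oo] while [ln] has the default value 0; both have positive part
    0. *)
Let YE w : (maxe (lne (kappa w)%:E) 0 = (Y w)%:E)%E.
Proof.
rewrite /Y /=; case: ifPn => [k0|_]; last by rewrite -EFin_max.
by rewrite ln0// maxxx; apply/max_idPr; rewrite leNye.
Qed.

Let large n := [set w | expR (c * n%:R) < kappa w].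

Let measurable_large n : measurable (large n).
Proof.
rewrite (_ : large n = setT `&` kappa @^-1` `]expR (c * n%:R), +oo[).
  by apply: mkappa => //; exact: measurable_itv.
by apply/seteqP; split => w /=; rewrite in_itv/= andbT => // -[].
Qed.

Let large_Y n w : large n w -> c * n%:R < Y w.
Proof.
move=> /= h; rewrite /Y lt_max; apply/orP; left.
have k0 : 0 < kappa w by apply: lt_trans h; exact: expR_gt0.
by rewrite -ltr_expR lnK.
Qed.

(** A layer-cake count of the levels [c], [2 c], ... below [Y w]. The bound [c * n%:R] is carried
    along because, once level [n.+1] is exceeded, it keeps the new sum below [Y w]. *)
Let count_large n w : \sum_(1 <= k < n.+1) c * \1_(large k) w <= Y w /\
  \sum_(1 <= k < n.+1) c * \1_(large k) w <= c * n%:R.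
Proof.
elim: n => [|n [ih1 ih2]].
  by rewrite big_geq// mulr0 lexx /Y le_max lexx orbT.
rewrite big_nat_recr//= indicE; have [|nl] := boolP (w \in large n.+1).
  rewrite inE => /large_Y lY; rewrite mulr1.
  have : \sum_(1 <= k < n.+1) c * \1_(large k) w + c <= c * n.+1%:R.
    by rewrite -natr1 mulrDr mulr1 lerD2r.
  by move=> h; split => //; exact: le_trans h (ltW lY).
rewrite mulr0 addr0; split => //; apply: (le_trans ih2).
by rewrite ler_pM2l// ler_nat.
Qed.

Let sum_large : (\sum_(k <oo) P (large k) < +oo)%E.
Proof.
pose J := (\int[P]_w (Y w)%:E)%E.
have mY : measurable_fun setT Y.
  apply: measurable_maxr => //; apply: measurableT_comp => //; exact: measurable_ln.
have J0 : (0 <= J)%E.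
  by apply: integral_ge0 => w _; rewrite lee_fin /Y le_max lexx orbT.
have Jfin : J \is a fin_num.
  rewrite ge0_fin_numE// /J; apply: le_lt_trans log_integrable.
  by under eq_integral do rewrite -YE.
have part n : ((\sum_(1 <= k < n.+1) c%:E * P (large k)) <= J)%E.
  have -> : (\sum_(1 <= k < n.+1) c%:E * P (large k) =
      \int[P]_w (\sum_(1 <= k < n.+1) c * \1_(large k) w)%:E)%E.
    under [RHS]eq_integral do rewrite -sumEFin.
    rewrite ge0_integral_sum//.
    - apply: eq_bigr => k _; rewrite -[in LHS](setIT (large k)) -integral_indic//.
      rewrite -ge0_integralZl_EFin//; last exact: ltW.
      exact/measurable_EFinP.
    - move=> k; apply/measurable_EFinP; apply: measurable_funM => //.
    - by move=> k w _; rewrite lee_fin mulr_ge0// ltW.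
  apply: ge0_le_integral => //.
  - by move=> w _; rewrite lee_fin sumr_ge0// => k _; rewrite mulr_ge0// ltW.
  - apply/measurable_EFinP; apply: measurable_sum => k; exact: measurable_funM.
  - exact/measurable_EFinP.
  - by move=> w _; rewrite lee_fin; exact: (count_large n w).1.
have bound n : ((\sum_(0 <= k < n) P (large k)) <= 1 + (c^-1)%:E * J)%E.
  case: n => [|n]; first by rewrite big_geq// adde_ge0// mule_ge0// lee_fin invr_ge0 ltW.
  rewrite big_ltn//; apply: leeD; first exact: probability_le1.
  have := part n; rewrite -ge0_sume_distrr//.
  move=> /(lee_wpmul2l (x := (c^-1)%:E)); rewrite lee_fin invr_ge0 ltW// => /(_ isT).
  by rewrite muleA -EFinM mulVf ?gt_eqF// mul1e.
apply: (@le_lt_trans _ _ (1 + (c^-1)%:E * J)%E); last first.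
  by rewrite -(fineK Jfin) -EFinM -EFinD ltry.
apply: lime_le; first exact: is_cvg_nneseries.
by apply: nearW => n; exact: bound.
Qed.

(** Borel-Cantelli: beyond a random index, [kappa] at the n-th iterate is at most [expR (c * n%:R)],
    and the series is dominated by a geometric one. The map is generic here and is [thetaV] in the
    application. *)
Lemma ae_past_variation_fin :
  {ae P, forall w, (past_variation theta r kappa w < +oo)%E}.
Proof.
pose F n := iter n theta @^-1` large n.
have mF n : measurable (F n) by exact: measurable_iter_preimage.
have P0 : P (lim_sup_set F) = 0%E.
  apply: lim_sup_set_cvg0 => //.
  rewrite (eq_eseriesr (g := fun n => P (large n))); first exact: sum_large.
  by move=> n _; exact: (preserving_iter mtheta preserving n (measurable_large n)).
exists (lim_sup_set F); split => //.
  by apply: bigcapT_measurable => n; exact: bigcup_measurable.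
move=> w /= h; apply: contrapT => nL; apply: h.
have [N hN] : exists N, forall n, (N <= n)%N -> ~ F n w.
  apply: contrapT => nN; apply: nL => N _; apply: contrapT => nF.
  apply: nN; exists N => n Nn Fn; apply: nF; by exists n.
pose q := expR (- c).
have q0 : 0 < q by exact: expR_gt0.
have q1 : q < 1 by rewrite -expR0 ltr_expR oppr_lt0.
pose a k := kappa (iter k theta w) * r ^+ k.
have a0 k : 0 <= a k by rewrite mulr_ge0// exprn_ge0// ltW.
have aq k : (N <= k)%N -> a k <= q ^+ k.
  move=> /hN/negP; rewrite -leNgt => kle.
  rewrite /a {1}rE -/q exprMn; apply: (@le_trans _ _ (expR (c * k%:R) * (q ^+ k * q ^+ k))).
    by apply: ler_wpM2r => //; rewrite mulr_ge0// exprn_ge0// ltW.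
  rewrite mulrA /q -expRM_natr -expRD mulNr subrr expR0 mul1r//.
have bound n : \sum_(1 <= k < n) a k <= \sum_(1 <= k < N) a k + (1 - q)^-1.
  have [nN|Nn] := leqP n N.
    apply: (@le_trans _ _ (\sum_(1 <= k < N) a k)); last first.
      by rewrite lerDl invr_ge0 subr_ge0 ltW.
    have [n1|n1] := leqP n 1; first by rewrite big_geq// sumr_ge0.
    by rewrite (big_cat_nat (n := n) (ltnW n1) nN)/= lerDl sumr_ge0.
  have key : \sum_(1 <= k < n) a k <= \sum_(1 <= k < N) a k + (q ^+ N - q ^+ n) / (1 - q).
    rewrite -(subnKC (ltnW Nn)); elim: (n - N)%N => [|k ih].
      by rewrite addn0 subrr mul0r addr0.
    (* The sum starts at 1, so going from 0 to 1 adds no term. *)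
    rewrite addnS; have [e|e] := posnP (N + k)%N.
      rewrite e big_geq//; move/eqP: e; rewrite addn_eq0 => /andP[/eqP-> _].
      by rewrite big_geq// add0r expr0 divr_ge0 ?subr_ge0 ?ltW// expr1.
    rewrite big_nat_recr//=; apply: (le_trans (lerD ih (aq _ (leq_addr _ _)))).
    rewrite exprS le_eqVlt; apply/orP; left; apply/eqP; field.
    by rewrite subr_eq0 gt_eqF.
  apply: (le_trans key); rewrite lerD2l ler_pdivrMr ?subr_gt0// mulVf ?subr_eq0 ?gt_eqF//.
  have : q ^+ N <= 1 by apply: exprn_ile1; exact: ltW.
  have : 0 <= q ^+ n by apply: exprn_ge0; exact: ltW.
  lra.
rewrite /past_variation.
apply: (@le_lt_trans _ _ (\sum_(1 <= k < N) a k + (1 - q)^-1)%:E); last exact: ltry.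
apply: lime_le.
  by apply: is_cvg_nneseries => n _ _; rewrite lee_fin; exact: a0.
by apply: nearW => n; rewrite sumEFin lee_fin; exact: bound.
Qed.

End log_summability.

(** * Measurable choice of the random times *)

Lemma first_hit d (Omega : measurableType d) (A : nat -> set Omega) :
  (forall k, measurable (A k)) -> exists l : Omega -> nat,
    measurable_fun setT l /\ forall w, (exists k, A k w) -> A (l w) w.
Proof.
move=> mA.
(* The least index, with default 0 on the points in no [A k]; its level sets are countable Boolean
   combinations of the [A k]. *)
have h w : exists k, (A k w /\ forall i, (i < k)%N -> ~ A i w) \/
    (k = 0%N /\ forall i, ~ A i w).
  have [e|e] := pselect (exists k, A k w); last first.
    by exists 0%N; right; split => // i Ai; apply: e; exists i.
  have e' : exists k, `[< A k w >] by case: e => k /asboolP; exists k.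
  exists (ex_minn e'); left; case: ex_minnP => k /asboolP Ak kmin; split => //.
  by move=> i; rewrite ltnNge => + /asboolP/kmin => /negP.
have [l hl] := choice h; exists l; split; last first.
  by move=> w [k Ak]; case: (hl w) => [[]//|[_ /(_ k)]].
have mlk k : measurable [set w | l w = k].
  rewrite (_ : mkset _ = (A k `\` \bigcup_(i in `I_k) A i) `|`
     (if k == 0%N then ~` \bigcup_i A i else set0)).
    apply: measurableU; last by case: ifP => // _; apply: measurableC; exact: bigcupT_measurable.
    by apply: measurableD => //; exact: bigcup_measurable.
  apply/seteqP; split => w /=.
    move=> <-; case: (hl w) => [[Al lmin]|[-> noA]].
      by left; split => // -[i /= il]; exact: lmin.
    by right => -[i _]; exact: noA.
  have [[Al lmin]|[l0 noA]] := hl w; last first.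
    by case=> [[/noA]//|]; case: ifP => // /eqP->.
  case=> [[Ak kmin]|]; last first.
    by case: ifP => // _ /= noA; exfalso; apply: noA; exists (l w).
  apply/eqP; rewrite eqn_leq; apply/andP; split; rewrite leqNgt; apply/negP.
    by move=> /lmin.
  by move=> lk; apply: kmin; exists (l w).
move=> _ Y _; rewrite setTI (_ : l @^-1` Y = \bigcup_(k in Y) [set w | l w = k]).
  by apply: bigcup_measurable => k _.
by apply/seteqP; split => w /=; [move=> Yl; exists (l w)|move=> [k Yk /= ->]].
Qed.

Section measurable_visits.
Context d (Omega : measurableType d) (R : realType).
Variables (theta thetaV : Omega -> Omega) (r : R) (kappa : Omega -> R).
Variable mu : Omega -> set natseq -> \bar R.
Hypothesis mtheta : measurable_fun setT theta.
Hypothesis mthetaV : measurable_fun setT thetaV.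
Hypotheses (r0 : 0 < r) (mkappa : measurable_fun setT kappa).
Hypothesis kappa0 : forall w, 0 <= kappa w.
Hypothesis mmu : forall B, measurable B -> measurable_fun setT (mu ^~ B).
Local Notation S := (past_variation thetaV r kappa).

(** The terms being nonnegative, the condition says that every partial sum is at most [M]. *)
Lemma measurable_past_variation_le (M : R) : measurable [set w | (S w <= M%:E)%E].
Proof.
have term0 w k : (0 <= (kappa (iter k thetaV w) * r ^+ k)%:E)%E.
  by rewrite lee_fin mulr_ge0// exprn_ge0// ltW.
rewrite (_ : mkset _ = \bigcap_n (setT `&` [set w |
    ((\sum_(1 <= k < n) kappa (iter k thetaV w) * r ^+ k)%:E <= M%:E)%E])).
  apply: bigcapT_measurable => n; apply: measurable_lee => //.
  apply/measurable_EFinP; apply: measurable_sum => k; apply: measurable_funM => //.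
  by apply: measurableT_comp => //; exact: measurable_iter.
apply/seteqP; split => w /=.
  move=> h n _; split => //=; apply: le_trans h; rewrite -sumEFin.
  by apply: nneseries_lim_ge.
move=> h; apply: lime_le; first exact: is_cvg_nneseries.
by apply: nearW => n; have [_ /=] := h n I; rewrite -sumEFin.
Qed.

Lemma measurable_visit a s eta M M' :
  measurable (visit theta thetaV r kappa mu a s eta M M').
Proof.
rewrite (_ : visit _ _ _ _ _ _ _ _ _ _ = [set w | (S w <= M%:E)%E] `&`
  (iter s theta @^-1` [set w | (S w <= M'%:E)%E]) `&`
  \bigcap_b (setT `&` [set w | (eta%:E * mu (iter s theta w) (cyl [:: b]) <=
      mu w (cyl a `&` iter s shift_seq @^-1` cyl [:: b]))%E])).
  apply: measurableI; first apply: measurableI.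
  - exact: measurable_past_variation_le.
  - apply: measurable_iter_preimage => //; exact: measurable_past_variation_le.
  - apply: bigcapT_measurable => b; apply: measurable_lee => //.
      apply: emeasurable_funM => //.
      have mb := mmu (measurable_cyl [:: b]).
      by apply: (measurableT_comp mb); exact: measurable_iter.
    apply: mmu; apply: measurableI; first exact: measurable_cyl.
    by apply: measurable_shift_preimage; exact: measurable_cyl.
apply/seteqP; split => w /=.
  by move=> [h1 h2 h3]; split; [split|move=> b _; split; [|exact: h3]].
by move=> [[h1 h2] h3]; split => // b; have [] := h3 b I.
Qed.

Lemma measurable_visits (G : set Omega) n0 s K l : measurable G ->
  measurable [set w | visits theta G n0 s K l w].
Proof.
move=> mG; elim: K l => [|K ih] l.
  rewrite (_ : mkset _ = if (n0 <= l)%N then setT else set0).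
    by case: ifP.
  by apply/seteqP; split => w /=; case: ifP.
rewrite (_ : mkset _ = \bigcup_(t in [set t | (t + s <= l)%N])
   ([set w | visits theta G n0 s K t w] `&` iter t theta @^-1` G)).
  apply: bigcup_measurable => t _; apply: measurableI => //.
  exact: measurable_iter_preimage.
apply/seteqP; split => w /=.
  by move=> [t [tl vt Gt]]; exists t.
by move=> [t /= tl [vt Gt]]; exists t.
Qed.

Lemma visits_forward (G : set Omega) n0 s K w :
  (forall N, exists2 i, (N <= i)%N & G (iter i theta w)) ->
  exists l, visits theta G n0 s K l w.
Proof.
move=> rec; suff [l [_ vl]] : exists l, (0 <= l)%N /\ visits theta G n0 s K l w.
  by exists l.
have mono K' l l' : (l <= l')%N -> visits theta G n0 s K' l w ->
    visits theta G n0 s K' l' w.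
  case: K' => [|K'] /= ll'; first by move=> /leq_trans; apply.
  by move=> [t [tl vt Gt]]; exists t; split => //; exact: leq_trans tl ll'.
elim: K => [|K [l [_ vl]]]; first by exists n0; split => /=.
have [t lt Gt] := rec l; exists (t + s)%N; split => //=; exists t; split => //.
exact: (mono _ _ _ lt vl).
Qed.

(** Going into the past, the last window is found first. The induction therefore keeps the final
    [i0] steps free, and places the last window at a past time [i] with [i0 + s <= i]. *)
Lemma visits_backward (G : set Omega) n0 s K w : cancel thetaV theta ->
  (forall N, exists2 i, (N <= i)%N & G (iter i thetaV w)) ->
  exists k, visits theta G n0 s K k (iter k thetaV w).
Proof.
move=> VK rec; suff /(_ 0%N)[k _] : forall i0, exists2 k, (i0 <= k)%N &
    visits theta G n0 s K (k - i0) (iter k thetaV w).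
  by rewrite subn0; exists k.
elim: K => [|K ih] i0; first by exists (i0 + n0)%N; rewrite ?leq_addr//= addKn.
have [i i0i Gi] := rec (i0 + s)%N; have [k ik vk] := ih i.
exists k; first by apply: leq_trans ik; apply: leq_trans i0i; exact: leq_addr.
exists (k - i)%N; split => //; first by clear -i0i ik; lia.
by rewrite iter_cancel ?leq_subr// subKn.
Qed.

End measurable_visits.

(** * A visit set of positive probability *)

Section visit_set.
Context d (Omega : measurableType d) (R : realType) (P : probability Omega R).
Variables (theta thetaV : Omega -> Omega) (r : R) (kappa : Omega -> R).
Variable mu : Omega -> set natseq -> \bar R.
Hypothesis mtheta : measurable_fun setT theta.
Hypothesis mthetaV : measurable_fun setT thetaV.
Hypotheses (r0 : 0 < r) (mkappa : measurable_fun setT kappa).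
Hypothesis kappa0 : forall w, 0 <= kappa w.
Hypothesis mmu : forall B, measurable B -> measurable_fun setT (mu ^~ B).
Hypothesis mu0 : forall w B, measurable B -> (0 <= mu w B)%E.
Local Notation S := (past_variation thetaV r kappa).
Hypothesis Sfin : {ae P, forall w, forall i, (S (iter i theta w) < +oo)%E}.

Lemma past_variation_ge0 w : (0 <= S w)%E.
Proof.
by apply: nneseries_ge0 => k _ _; rewrite lee_fin mulr_ge0// exprn_ge0// ltW.
Qed.

Lemma past_variation_le_nat w : (S w < +oo)%E -> exists M : nat, (S w <= M%:R%:E)%E.
Proof.
move=> Sw; have Sf : S w \is a fin_num by rewrite ge0_fin_numE ?past_variation_ge0.
exists (Num.bound (fine (S w))); rewrite -(fineK Sf) lee_fin ltW//.
by apply: archi_boundP; apply: fine_ge0; exact: past_variation_ge0.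
Qed.

Lemma bounded_past_gt0 : exists M : nat, (0 < P [set w | (S w <= M%:R%:E)%E])%E.
Proof.
apply: contrapT => no.
have {}no M : P [set w | (S w <= M%:R%:E)%E] = 0%E.
  apply/eqP; rewrite eq_le measure_ge0 andbT leNgt; apply/negP => h.
  by apply: no; exists M.
have : P.-negligible setT.
  have [A [mA A0 hA]] := Sfin.
  apply: (@negligibleS _ _ _ P (A `|` \bigcup_M [set w | (S w <= M%:R%:E)%E])).
    move=> w _; have [Aw|nA] := pselect (A w); first by left.
    right; have : forall i, (S (iter i theta w) < +oo)%E.
      by apply: contrapT => h; apply: nA; apply: hA.
    by move=> /(_ 0%N)/past_variation_le_nat[M hM]; exists M.
  apply: negligibleU; first by exists A; split.
  apply: negligible_bigcup => M; apply/negligibleP; last exact: no.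
  exact: measurable_past_variation_le.
move=> /negligibleP h; have := h measurableT.
rewrite [LHS]probability_setT => /eqP; apply/negP; exact: oner_neq0.
Qed.

(** Were all these sets null, so would be their union over the words of length [j], the times [s],
    the natural [M'] and the rounded values of [eta]; but this countable union covers almost every
    point with past distortion at most [M]. *)
Lemma visit_set_gt0 (M : R) j : (0 < P [set w | (S w <= M%:E)%E])%E ->
  {ae P, forall w, exists (a : seq nat) (s : nat) (eta : R),
    [/\ size a = j, (j <= s)%N, 0 < eta &
     forall b, (eta%:E * mu (iter s theta w) (cyl [:: b]) <=
       mu w (cyl a `&` iter s shift_seq @^-1` cyl [:: b]))%E]} ->
  exists (a : seq nat) (s : nat) (eta M' : R),
    [/\ size a = j, (j <= s)%N, 0 < eta < 1, 0 <= M' &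
        (0 < P (visit theta thetaV r kappa mu a s eta M M'))%E].
Proof.
move=> PM words_ae; apply: contrapT => no.
(* The proportion is rounded down to the inverse of [p.+2], which also keeps it below 1. *)
pose V (x : seq nat * nat * nat * nat) : set Omega :=
  visit theta thetaV r kappa mu x.1.1.1 x.1.1.2 (x.1.2.+2%:R^-1) M x.2%:R.
have mV x : measurable (V x) by exact: measurable_visit.
have V0 x : size x.1.1.1 = j -> (j <= x.1.1.2)%N -> P.-negligible (V x).
  move=> sx jx; apply/negligibleP => //; apply/eqP.
  rewrite eq_le measure_ge0 andbT leNgt; apply/negP => h.
  apply: no; exists x.1.1.1, x.1.1.2, x.1.2.+2%:R^-1, x.2%:R; split => //.
  by rewrite invr_gt0 ltr0n/= invf_lt1 ?ltr1n ?ltr0n.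
have : P.-negligible [set w | (S w <= M%:E)%E].
  have [A [mA A0 hA]] := words_ae; have [C [mC C0 hC]] := Sfin.
  pose U (o : option (seq nat * nat * nat * nat)) : set Omega :=
    if o is Some x then
      (if (size x.1.1.1 == j) && (j <= x.1.1.2)%N then V x else set0)
    else set0.
  pose big : set Omega := A `|` C `|` \bigcup_n U (choice.unpickle n).
  suff [sub nbig] : [set w | (S w <= M%:E)%E] `<=` big /\ P.-negligible big.
    exact: negligibleS sub nbig.
  split.
    move=> w /= Sw; have [Aw|nA] := pselect (A w); first by left; left.
    have [Cw|nC] := pselect (C w); first by left; right.
    right; have [a [s [eta [sa js eta0 h]]]] : exists (a : seq nat) (s : nat) (eta : R),
      [/\ size a = j, (j <= s)%N, 0 < eta &
       forall b, (eta%:E * mu (iter s theta w) (cyl [:: b]) <=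
         mu w (cyl a `&` iter s shift_seq @^-1` cyl [:: b]))%E].
      by apply: contrapT => h; apply: nA; apply: hA.
    have /(_ s)/past_variation_le_nat[M' hM'] : forall i, (S (iter i theta w) < +oo)%E.
      by apply: contrapT => h'; apply: nC; apply: hC.
    pose p := Num.bound eta^-1; pose x := (a, s, p, M').
    exists (choice.pickle x); first exact: I.
    rewrite choice.pickleK /U/= sa js eqxx/=.
    split => // b; apply: le_trans (h b); apply: lee_wpmul2r.
      by apply: mu0; exact: measurable_cyl.
    rewrite lee_fin -[leRHS]invrK lef_pV2 ?posrE ?invr_gt0 ?ltr0n//.
    have : eta^-1 < p%:R by apply: archi_boundP; rewrite invr_ge0 ltW.
    by move=> /ltW/le_trans; apply; rewrite ler_nat (leq_trans (leqnSn p)).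
  apply: negligibleU; first by apply: negligibleU; [exists A; split|exists C; split].
  apply: negligible_bigcup => n; rewrite /U.
  case: (choice.unpickle n) => [x|]; last exact: negligible_set0.
  by case: ifP => [/andP[/eqP sx jx]|_]; [exact: V0|exact: negligible_set0].
move=> /negligibleP h; move: PM; rewrite [Z in (_ < Z)%E]h ?ltxx//.
exact: measurable_past_variation_le.
Qed.

End visit_set.

(** * Prescribed accuracy in both time directions *)

Section rates.
Context d (Omega : measurableType d) (R : realType) (P : probability Omega R).
Variables (theta thetaV : Omega -> Omega).
Variables (W1 : Omega -> set nat) (alpha : Omega -> nat -> nat -> bool).
Variables (r : R) (kappa : Omega -> R) (phi : Omega -> natseq -> R).
Variable mu : Omega -> set natseq -> \bar R.
Local Notation X := (fibre theta W1 alpha).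
Local Notation regular := (regular theta W1 alpha r kappa phi mu).
Local Notation S := (past_variation thetaV r kappa).
Hypothesis erg : ergodic_automorphism P theta thetaV.
Hypotheses (r0 : 0 < r) (r1 : r < 1) (mkappa : measurable_fun setT kappa).
Hypothesis kappa0 : forall w, 0 <= kappa w.
Hypothesis mphi : forall w, measurable_fun (X w) (phi w).
Hypothesis rp : random_probability P theta W1 alpha mu.
Hypothesis Sfin : {ae P, forall w, forall i, (S (iter i theta w) < +oo)%E}.
Hypothesis words_ae : forall j, (0 < j)%N ->
  {ae P, forall w, exists (a : seq nat) (s : nat) (eta : R),
    [/\ size a = j, (j <= s)%N, 0 < eta &
     forall b, (eta%:E * mu (iter s theta w) (cyl [:: b]) <=
       mu w (cyl a `&` iter s shift_seq @^-1` cyl [:: b]))%E]}.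

Lemma thetaV_preserving A : measurable A -> P (thetaV @^-1` A) = P A.
Proof.
move=> mA; have mV : measurable (thetaV @^-1` A).
  exact: (measurable_iter_preimage (automorphism_measurableV erg) 1 mA).
rewrite -(automorphism_preserving erg mV); congr (P _).
by apply/seteqP; split => w; rewrite /preimage/= (automorphism_cancel erg).
Qed.

Lemma thetaV_ergodic A : measurable A -> thetaV @^-1` A = A ->
  P A = 0%E \/ P A = 1%E.
Proof.
move=> mA AE; apply: (automorphism_ergodic erg mA); rewrite -{1}AE.
by apply/seteqP; split => w; rewrite /preimage/= (automorphism_cancel erg).
Qed.

(** [V] comes before [f] and [g], so the random times will not depend on them. The same sets serve
    both directions: backwards, the starting point [iter k thetaV w] must lie in [V k]. *)
Lemma decay_rate (e : R) : 0 < e <= 1 -> exists V : nat -> set Omega,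
  [/\ forall l, measurable (V l),
      {ae P, forall w, exists l, V l w},
      {ae P, forall w, exists k, V k (iter k thetaV w)} &
  forall w l, V l w -> (forall i, regular (iter i theta w)) ->
  forall (f : Omega -> natseq -> R) (D : R) (g : natseq -> R),
    lipschitz_const theta W1 alpha r w f = D%:E ->
    (\int[mu w]_(x in X w) (f w x)%:E = 0)%E ->
    measurable_fun (X (iter l theta w)) g ->
    (\int[mu (iter l theta w)]_(x in X (iter l theta w)) `|g x|%:E < +oo)%E ->
    (`| \int[mu w]_(x in X w) (f w x * g (iter l shift_seq x))%:E | <=
     (e * D)%:E *
     \int[mu (iter l theta w)]_(x in X (iter l theta w)) `|g x|%:E)%E].
Proof.
move=> /andP[e0 e1].
have mth := automorphism_measurable erg; have mthV := automorphism_measurableV erg.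
have mmu := rp_measurable rp.
have mu0 w B : measurable B -> (0 <= mu w B)%E.
  by move=> mB; have [] := rp_unit_interval rp w mB.
(* The final bound is [2 * D * (1 - eta') ^+ K + 16 * D * eps]; with [e / 4] for the power below,
   each term is at most [e * D / 2]. *)
pose eps := e / 32.
have eps0 : 0 < eps by rewrite divr_gt0.
have eps1 : eps <= 1 by rewrite /eps; lra.
have [M PM] := bounded_past_gt0 mthV r0 mkappa kappa0 Sfin.
have lneps : 0 < ln (1 + eps) by rewrite ln_gt0// ltrDl.
have M0 : 0 <= M%:R :> R by exact: ler0n.
(* This makes [2 * r ^+ j.+1 * M%:R] at most [ln (1 + eps)], the added 1 keeping the divisor
   positive. The word has length [j.+1], to be nonempty. *)
have [j hj] := expr_small r0 r1 (divr_gt0 lneps (ltr_wpDl (mulr_ge0 (ler0n R 2) M0) ltr01)).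
have [a [s [eta [M' [sa js eta01 M'0 PG]]]]] :=
  visit_set_gt0 mth mthV r0 mkappa kappa0 mmu mu0 Sfin PM (words_ae (ltn0Sn j)).
have [eta0 eta1] := andP eta01.
have [n0 hn0] := expr_small r0 r1 eps0.
set G := visit _ _ _ _ _ _ _ _ _ _ in PG.
have mG : measurable G by exact: measurable_visit.
pose eta' := eta * expR (- (2 * M')).
have eta'0 : 0 < eta' by rewrite mulr_gt0// expR_gt0.
have eta'1 : eta' < 1.
  apply: le_lt_trans eta1; apply: ler_piMr; first exact: ltW.
  by rewrite -expR0 ler_expR oppr_le0 mulr_ge0.
have [K hK] : exists K, (1 - eta') ^+ K <= e / 4.
  by apply: expr_small; [rewrite subr_gt0|rewrite ltrBlDr ltrDl|rewrite divr_gt0].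
exists (fun l => [set w | visits theta G n0 s K l w]); split.
- by move=> l; exact: measurable_visits.
- apply: filterS (ae_recurrent mth (automorphism_preserving erg)
    (automorphism_ergodic erg) mG PG) => w.
  exact: visits_forward.
- apply: filterS (ae_recurrent mthV thetaV_preserving thetaV_ergodic mG PG) => w rec.
  by apply: visits_backward rec; exact: (automorphism_cancelV erg).
move=> w l /= vis reg f D g fD f0 mg gfin.
have D0 : 0 <= D by rewrite -lee_fin -fD lipschitz_const_ge0.
have a0 : (0 < size a)%N by rewrite sa.
have as_ : (size a <= s)%N by rewrite sa.
have aM : expR (2 * (r ^+ size a * M%:R)) <= 1 + eps.
  rewrite -[leRHS]lnK ?posrE ?addr_gt0// ler_expR sa.
  have : r ^+ j.+1 <= ln (1 + eps) / (2 * M%:R + 1).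
    apply: le_trans hj; rewrite exprS; apply: ler_piMl; last exact: ltW.
    by apply: exprn_ge0; exact: ltW.
  rewrite ler_pdivlMr; last by rewrite ltr_wpDl// mulr_ge0.
  have : 0 <= r ^+ j.+1 by rewrite exprn_ge0// ltW.
  lra.
have eps01 : 0 <= eps <= 1 by rewrite ltW.
have H := decay_at_visits mphi (automorphism_cancel erg) r0 r1 kappa0 a0 as_
  eta0 eps01 aM hn0 M'0 reg fD f0 mg gfin vis.
apply: (le_trans H); apply: lee_wpmul2r.
  rewrite (eq_integral_set_function _ _ (regular_measure (reg l))).
  by apply: integral_ge0 => x _; rewrite lee_fin.
rewrite lee_fin -/eta'.
have : (1 - eta') ^+ K * (2 * D) <= e / 4 * (2 * D).
  by apply: ler_wpM2r => //; rewrite mulr_ge0.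
by rewrite /eps; lra.
Qed.

End rates.

(** * Almost sure properties of the base points *)

Section generic_points.
Context d (Omega : measurableType d) (R : realType) (P : probability Omega R).
Variables (theta thetaV : Omega -> Omega).
Variables (W1 : Omega -> set nat) (alpha : Omega -> nat -> nat -> bool).
Variables (Omega_bi Omega_bp : set Omega) (I : set nat).
Variables (r : R) (kappa : Omega -> R) (phi : Omega -> natseq -> R).
Variable mu : Omega -> set natseq -> \bar R.
Local Notation X := (fibre theta W1 alpha).
Local Notation regular := (regular theta W1 alpha r kappa phi mu).
Local Notation global := (global_words P theta W1 alpha 1).
Local Notation Oword := (Omega_word theta W1 alpha).
Local Notation cylX := (cylinder theta W1 alpha).
Hypothesis erg : ergodic_automorphism P theta thetaV.
Hypothesis hbip : bip P theta thetaV W1 alpha Omega_bi Omega_bp I.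
Hypothesis hphi : H_hat P theta W1 alpha Omega_bi Omega_bp r kappa phi.
Hypothesis ruelle1 : {ae P, forall w, forall x, X (theta w) x ->
    ruelle theta W1 alpha phi w (fun=> 1) x = 1%E}.
Hypothesis rp : random_probability P theta W1 alpha mu.
Hypothesis dual : ruelle_dual_invariant P theta W1 alpha phi mu.
Hypothesis mphi : forall w, measurable_fun (X w) (phi w).

Lemma ae_regular : {ae P, forall w, regular w}.
Proof.
have [[_ _ _ kvar] _] := hphi.
apply: filterS (filterI (filterI (rp_ae rp) ruelle1) (filterI dual kvar)).
move=> w [[[hm supp] h1] [h2 h3]]; have prE := fibre_measureE hm.
split => //; rewrite -supp; apply/seteqP; split => x h U oU Ux;
  have := h U oU Ux; rewrite prE//; exact: sub_sigma_algebra.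
Qed.

(** Mixing is given for global letters only; the others are countably many, each realised on a
    negligible set. *)
Lemma ae_global : {ae P, forall w, forall c, Oword [:: c] w -> global [:: c]}.
Proof.
apply: ae_foralln => c; have [g|ng] := pselect (global [:: c]); first exact: aeW.
have neg : P.-negligible (Oword [:: c]).
  by apply: contrapT => h; apply: ng.
apply: negligibleS neg => w /= /not_implyP[].
by [].
Qed.

Definition mixes (a b : nat) (w : Omega) : Prop :=
  W1 w a -> exists N, forall n, (N <= n)%N -> Oword [:: b] (iter n theta w) ->
    cylX [:: a] w `&` iter n shift_seq @^-1` cylX [:: b] (iter n theta w) !=set0.

Lemma ae_mixes : {ae P, forall w, forall a b,
  global [:: a] -> global [:: b] -> mixes a b w}.
Proof.
apply: ae_foralln => a; apply: ae_foralln => b.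
have [ga|nga] := pselect (global [:: a]); last exact: aeW.
have [gb|ngb] := pselect (global [:: b]); last exact: aeW.
have [N [_ hN]] := bip_mixing hbip ga gb.
by apply: filterS hN => w hw _ _ Wa; exists (N w) => n Nn Ob; exact: hw.
Qed.

Lemma ae_words j : (0 < j)%N ->
  {ae P, forall w, exists (a : seq nat) (s : nat) (eta : R),
    [/\ size a = j, (j <= s)%N, 0 < eta &
     forall b, (eta%:E * mu (iter s theta w) (cyl [:: b]) <=
       mu w (cyl a `&` iter s shift_seq @^-1` cyl [:: b]))%E]}.
Proof.
move=> j0; have mth := automorphism_measurable erg.
have pres := automorphism_preserving erg.
have orb := @ae_orbit _ _ _ P theta mth pres.
have rec := ae_recurrent mth pres (automorphism_ergodic erg)
  (bip_bp_measurable hbip) (bip_bp_gt0 hbip).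
apply: filterS (filterI (filterI (orb _ ae_regular) (orb _ ae_global))
  (filterI (filterI (orb _ ae_mixes) (orb _ hphi.2)) rec)).
move=> w [[reg glob] [[mix var1] recw]].
have var1' i : Omega_bp (iter i.+1 theta w) ->
    (Defs.variation theta W1 alpha 1 (iter i theta w) phi < +oo)%E.
  by move=> h; apply: var1; right.
have mixing i a b : W1 (iter i theta w) a -> Oword [:: a] (iter i theta w) ->
    exists N, forall n, (N <= n)%N -> Oword [:: b] (iter (n + i) theta w) ->
    cylX [:: a] (iter i theta w) `&`
      iter n shift_seq @^-1` cylX [:: b] (iter (n + i) theta w) !=set0.
  move=> Wa Oa; have ga := glob i a Oa.
  (* A letter that is not global never occurs along this orbit. *)
  have [gb|ngb] := pselect (global [:: b]); last first.
    by exists 0%N => n _ Ob; exfalso; exact/ngb/(glob _ b Ob).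
  have [N hN] := mix i a b ga gb Wa.
  by exists N => n Nn; rewrite iterD; exact: hN.
have [a [s [eta [sa js eta0 h]]]] := visit_word_exists mphi (automorphism_cancel erg)
  (bip_finite hbip) (bip_preimages hbip) reg var1' mixing recw j0.
exists a, s, eta; split => // b; have mb := measurable_cyl [:: b].
rewrite (regular_measure (reg s))// (regular_measure (reg 0%N))//.
apply: measurableI; first exact: measurable_cyl.
exact: measurable_shift_preimage.
Qed.

Lemma ae_past_fin : 0 < r -> r < 1 ->
  {ae P, forall w, forall i, (past_variation thetaV r kappa (iter i theta w) < +oo)%E}.
Proof.
move=> r0 r1; have [[mk k0 klog _] _] := hphi.
apply: (@ae_orbit _ _ _ P theta (automorphism_measurable erg)
  (automorphism_preserving erg) (fun w => past_variation thetaV r kappa w < +oo)%E).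
apply: (ae_past_variation_fin (automorphism_measurableV erg)) => //.
exact: (thetaV_preserving erg).
Qed.

End generic_points.

Theorem mainTheorem9 (d : measure_display) (Omega : measurableType d)
    (R : realType) (P : probability Omega R) (theta thetaV : Omega -> Omega)
    (W1 : Omega -> set nat) (alpha : Omega -> nat -> nat -> bool)
    (Omega_bi Omega_bp : set Omega) (I : set nat)
    (r : R) (kappa : Omega -> R) (phi : Omega -> natseq -> R)
    (mu : Omega -> set natseq -> \bar R) :
  ergodic_automorphism P theta thetaV ->
  random_tmc P theta thetaV W1 alpha ->
  bip P theta thetaV W1 alpha Omega_bi Omega_bp I ->
  0 < r -> r < 1 ->
  measurable_on_X theta W1 alpha phi ->
  H_hat P theta W1 alpha Omega_bi Omega_bp r kappa phi ->
  {ae P, forall w, forall x, fibre theta W1 alpha (theta w) x ->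
    ruelle theta W1 alpha phi w (fun=> 1) x = 1%E} ->
  random_probability P theta W1 alpha mu ->
  ruelle_dual_invariant P theta W1 alpha phi mu ->
  exists (t c : R) (k l : nat -> Omega -> nat),
  [/\ 0 < t < 1, 0 < c,
      forall n, measurable_fun setT (k n),
      forall n, measurable_fun setT (l n) &
  forall f g : Omega -> natseq -> R,
    fibrewise_lipschitz P theta W1 alpha r f ->
    {ae P, forall w,
      (\int[mu w]_(x in fibre theta W1 alpha w) (f w x)%:E = 0)%E} ->
    measurable_on_X theta W1 alpha g ->
    {ae P, forall w,
      (\int[mu w]_(x in fibre theta W1 alpha w) `|g w x|%:E < +oo)%E} ->
  forall n : nat, {ae P, forall w,
    (let w1 := iter (l n w) theta w in
     `| \int[mu w]_(x in fibre theta W1 alpha w)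
          (f w x * g w1 (iter (l n w) shift_seq x))%:E |
     <= (2 * c * t ^+ n)%:E * lipschitz_const theta W1 alpha r w f
        * \int[mu w1]_(x in fibre theta W1 alpha w1) `|g w1 x|%:E)%E
    /\
    (let w1 := iter (k n w) thetaV w in
     `| \int[mu w1]_(x in fibre theta W1 alpha w1)
          (f w1 x * g w (iter (k n w) shift_seq x))%:E |
     <= 4%:E * holder_bound thetaV r kappa w * (t ^+ n)%:E
        * lipschitz_const theta W1 alpha r w1 f
        * \int[mu w]_(x in fibre theta W1 alpha w) `|g w x|%:E)%E}].
Proof.
move=> erg tmc hbip r0 r1 mphi hphi ruelle1 rp dual.
have mth := automorphism_measurable erg.
have mthV := automorphism_measurableV erg.
have thK := automorphism_cancel erg.
have thVK := automorphism_cancelV erg.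
have [[mk k0 _ _] _] := hphi.
have mW := tmc_alphabet tmc.
have mal := tmc_matrix tmc.
have mfib (f : Omega -> natseq -> R) w : measurable_on_X theta W1 alpha f ->
    measurable_fun (fibre theta W1 alpha w) (f w).
  exact: measurable_fun_fibre.
have mphi' w := mfib phi w mphi.
have Sfin := ae_past_fin erg hphi r0 r1.
have words_ae := ae_words erg hbip hphi ruelle1 rp dual mphi'.
(* Accuracy 2^{-n} at index [n]; this is why [t] is 1/2 and [c] can be 1. *)
have half n : 0 < (1 / 2 : R) ^+ n <= 1.
  by rewrite exprn_gt0 ?divr_gt0//= exprn_ile1//; lra.
have [V hV] := choice (fun n => decay_rate erg r0 r1 mk k0 mphi' rp Sfin words_ae (half n)).
have mV n i : measurable (V n i) by have [] := hV n.
have [l hl] := choice (fun n => first_hit (mV n)).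
have mVk n i : measurable (iter i thetaV @^-1` V n i) by exact: measurable_iter_preimage.
have [k hk] := choice (fun n => first_hit (mVk n)).
exists (1 / 2), 1, k, l; split => //.
- by apply/andP; split; lra.
- by move=> n; exact: (hk n).1.
- by move=> n; exact: (hl n).1.
move=> f g flip f0 mg gint n; have [_ Vf Vb Vdecay] := hV n.
have orb Q : {ae P, forall w, Q w} -> {ae P, forall w, forall i, Q (iter i theta w)}.
  exact: (ae_orbit mth (automorphism_preserving erg)).
have orbV Q : {ae P, forall w, Q w} -> {ae P, forall w, forall i, Q (iter i thetaV w)}.
  exact: (ae_orbit mthV (thetaV_preserving erg)).
have reg := orb _ (ae_regular hphi ruelle1 rp dual).
have lipE w : (lipschitz_const theta W1 alpha r w f < +oo)%E ->
    exists2 D, 0 <= D & lipschitz_const theta W1 alpha r w f = D%:E.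
  move=> h; have L0 := lipschitz_const_ge0 theta W1 alpha r f w.
  by apply: fin_num_ge0P => //; rewrite ge0_fin_numE.
(* The backward estimate starts at the preimage of order [k n w], which depends on [w]: regularity
   and the conditions on [f] are required on the whole backward orbit. *)
apply: filterS (filterI (filterI (filterI (orbV _ reg) (orbV _ flip))
  (filterI (orbV _ f0) (orb _ gint))) (filterI Vf Vb)).
move=> w [[[regw flipw] [f0w gw]] [Vfw Vbw]].
have int0 v : (forall i, regular theta W1 alpha r kappa phi mu (iter i theta v)) ->
    forall h, (0 <= \int[mu v]_(x in fibre theta W1 alpha v) `|h x|%:E)%E.
  move=> rv h; rewrite (eq_integral_set_function _ _ (regular_measure (rv 0%N))).
  by apply: integral_ge0 => x _; rewrite lee_fin.
split.
- set w1 := iter (l n w) theta w.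
  have [D D0 DE] := lipE w (flipw 0%N).
  have := Vdecay w (l n w) ((hl n).2 w Vfw) (regw 0%N) f D (g w1) DE (f0w 0%N)
    (mfib g w1 mg) (gw (l n w)).
  move=> /le_trans; apply; rewrite DE -EFinM; apply: lee_wpmul2r.
    by apply: int0 => i; rewrite /w1 -iterD; exact: (regw 0%N).
  rewrite lee_fin; apply: ler_wpM2r => //.
  by have := ltW (andP (half n)).1; lra.
- set w1 := iter (k n w) thetaV w.
  have w1E : iter (k n w) theta w1 = w by rewrite /w1 iter_cancel// subnn.
  have [D D0 DE] := lipE w1 (flipw (k n w)).
  have := Vdecay w1 (k n w) ((hk n).2 w Vbw) (regw (k n w)) f D (g w) DE (f0w (k n w)).
  rewrite w1E => /(_ (mfib g w mg) (gw 0%N)).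
  move=> /le_trans; apply; rewrite DE; apply: lee_wpmul2r.
    by apply: int0; exact: (regw 0%N).
  rewrite EFinM; apply: lee_wpmul2r; first by rewrite lee_fin.
  rewrite -[leLHS]mul1e; apply: lee_wpmul2r; first by rewrite lee_fin; exact: ltW (andP (half n)).1.
  (* [holder_bound] is the exponential of a nonnegative sum, hence at least 1, as is 4. *)
  rewrite -[leLHS]mule1; apply: lee_pmul => //.
    by rewrite lee_fin; lra.
  rewrite /holder_bound -expeR0 lee_expeR.
  by apply: nneseries_ge0 => i _ _; rewrite lee_fin mulr_ge0// exprn_ge0// ltW.
Qed.
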